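(* Assume that $\Omega$ admits a localizable homogeneous space $(\Omega,\varpi,\mathsf d)$. Let $\mathsf w$ be a doubling weight on $\Omega$ and assume that Assertion 4 (see context) holds. Let $\psi_{z,j}$, $z\in\Xi_j$, $j=0,1,2,\dots$, be the associated frame elements defined in the context. If $f\in L^2(\Omega,\mathsf w)$, then $$f=\sum_{j=0}^\infty\sum_{z\in\Xi_j}\langle f,\psi_{z,j}\rangle_{\mathsf w}\,\psi_{z,j}\qquad\text{in } L^2(\Omega,\mathsf w)$$ and $$\|f\|_{2,\mathsf w}=\Big(\sum_{j=0}^\infty\sum_{z\in\Xi_j}|\langle f,\psi_{z,j}\rangle_{\mathsf w}|^2\Big)^{1/2}.$$
   Context: Setting. $\Omega$ is a domain in $\mathbb R^d$ (either a set with nonempty interior or an algebraic surface) equipped with a metric $\mathsf d$; $B(x,r)=\{y\in\Omega:\mathsf d(x,y)<r\}$. The Lebesgue measure $\mathsf m$ on $\Omega$ is assumed to be doubling, i.e. $\mathsf m(B(x,2r))\le c\,\mathsf m(B(x,r))$ for all $x\in\Omega$, $r>0$, and $\min_{x\in\Omega}\mathsf m(B(x,\varepsilon))\ge c_\varepsilon>0$ for each $\varepsilon>0$. A weight is a nonnegative integrable function $\mathsf w$ on $\Omega$, and $\mathsf w(E)=\int_E\mathsf w\,\mathrm d\mathsf m$. It is a doubling weight if there is $L>0$ with $\mathsf w(B(x,2r))\le L\,\mathsf w(B(x,r))$ for all $x\in\Omega$ and $r>0$. $\Pi_n(\Omega)$ is the space of polynomials of degree at most $n$ restricted to $\Omega$.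 For a weight $\mathsf w$, $\langle f,g\rangle_{\mathsf w}=\int_\Omega fg\,\mathsf w\,\mathrm d\mathsf m$, $\|\cdot\|_{2,\mathsf w}$ is the norm of $L^2(\Omega,\mathsf w)$, $\mathcal V_n(\Omega,\mathsf w)$ is the space of polynomials in $\Pi_n(\Omega)$ orthogonal to $\Pi_{n-1}(\Omega)$ with respect to $\langle\cdot,\cdot\rangle_{\mathsf w}$, and $P_n(\mathsf w;\cdot,\cdot)$ is its reproducing kernel. A nonnegative $\widehat a\in C^\infty(\mathbb R)$ is an admissible cut-off function if either (a) $\operatorname{supp}\widehat a\subset[0,2]$ and $\widehat a(t)=1$ for $t\in[0,1]$ (as a function on $[0,\infty)$), or (b) $\operatorname{supp}\widehat a\subset[1/2,2]$. Put $L_n(\mathsf w;x,y)=\sum_{k=0}^\infty\widehat a(k/n)P_k(\mathsf w;x,y)$. $(\Omega,\varpi,\mathsf d)$ is called a localizable homogeneous space if $\varpi$ is a doubling weight with $\int_\Omega\varpi\,\mathrm d\mathsf m=1$ and the following hold for admissible $\widehat a$ and all $n=1,2,\dots$, with constants independent of $n,x,y,x_1,x_2$: Assertion 1: for every $\kappa>0$ and $x,y\in\Omega$, $|L_n(\varpi;x,y)|\le \dfrac{c_\kappa}{\sqrt{\varpi(B(x,n^{-1}))}\sqrt{\varpi(B(y,n^{-1}))}\,(1+n\,\mathsf d(x,y))^\kappa}$. Assertion 2: for some $\delta_0<1$, for every $\kappa>0$, $0<\delta\le\delta_0$ and $x_1\in B(x_2,\frac{\delta}{n})$, $y\in\Omega$,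 $|L_n(\varpi;x_1,y)-L_n(\varpi;x_2,y)|\le \dfrac{c_\kappa\,n\,\mathsf d(x_1,x_2)}{\sqrt{\varpi(B(x_1,n^{-1}))}\sqrt{\varpi(B(x_2,n^{-1}))}\,(1+n\,\mathsf d(x_2,y))^\kappa}$. Assertion 3: for sufficiently large $\kappa>0$, $\displaystyle\int_\Omega\frac{\varpi(y)}{\varpi(B(y,n^{-1}))(1+n\,\mathsf d(x,y))^\kappa}\,\mathrm d\mathsf m(y)\le c$ for all $x\in\Omega$. Assertion 4: $\Omega$ is compact, and for each $n$ and each $x\in\Omega$ there is a nonnegative polynomial $T_x$ of degree at most $n$ such that (1) $T_x(x)=1$, $T_x(y)\ge\delta'>0$ for $y\in B(x,\frac1n)$ with $\delta'$ independent of $n$, and for each $\gamma>1$, $0\le T_x(y)\le c_\gamma(1+n\,\mathsf d(x,y))^{-\gamma}$ for $y\in\Omega$; (2) there is a polynomial $q_n$ such that $q_n(x)T_x(y)$ is a polynomial of degree at most $rn$ in the $x$-variable, for some positive integer $r$, and $c_1\le q_n(x)\le c_2$ for $x\in\Omega$ for some positive numbers $c_1,c_2$. A discrete set $\Xi\subset\Omega$ is $\varepsilon$-separated if $\mathsf d(x,y)\ge\varepsilon$ for all distinct $x,y\in\Xi$; it is maximal $\varepsilon$-separated if in addition there is a constant $c_d>1$ (fixed, independent of $\varepsilon$) such that $1\le\sum_{z\in\Xi}\chi_{B(z,\varepsilon)}(x)\le c_d$ for all $x\in\Omega$, where $\chi_E$ is the characteristic function of $E$. Frame elements. Fix an admissible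 $\widehat a$ of type (b) with $\widehat a(t)\ge\rho>0$ for $t\in[3/5,5/3]$ and $[\widehat a(t)]^2+[\widehat a(2t)]^2=1$ for $t\in[1/2,1]$. For $j=0,1,2,\dots$ let $\Xi_j$ be a maximal $\frac{\delta}{2^j}$-separated subset of $\Omega$, where $\delta>0$ is chosen (small enough) so that there are numbers $\lambda_{z,j}>0$, $z\in\Xi_j$, with $\int_\Omega f\,\mathsf w\,\mathrm d\mathsf m=\sum_{z\in\Xi_j}\lambda_{z,j}f(z)$ for all $f\in\Pi_{2^j}(\Omega)$ and with $\lambda_{z,j}$ bounded above and below by positive constant multiples of $\mathsf w(B(z,2^{-j}))$; fix such $\lambda_{z,j}$. Put $F_0(x,z)=1$, $F_j(x,z)=L_{2^{j-1}}(\mathsf w;x,z)$ for $j\ge1$ (defined with the fixed $\widehat a$), and $\psi_{z,j}(x)=\sqrt{\lambda_{z,j}}\,F_j(x,z)$ for $z\in\Xi_j$, $j\ge 0$.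
   Formalization: Two corrections: the cubature formulas at level j are assumed exact on polynomials of degree at most 2^{j+1} instead of 2^j, and the weight w is assumed to satisfy w(Ω)=1; without these the expansion and norm identity can fail. *)

(* Defs.v *)
From HB Require Import structures.
From mathcomp Require Import all_boot all_order all_algebra.
From mathcomp Require Import all_classical all_reals all_analysis.
From mathcomp Require mpoly.
(* The notations of mpoly clash with those of mathcomp-analysis. *)
Import -(notations) mpoly.

Set Implicit Arguments.
Unset Strict Implicit.
Unset Printing Implicit Defensive.
Import Order.TTheory GRing.Theory Num.Theory numFieldNormedType.Exports.
Local Open Scope classical_set_scope.
Local Open Scope ring_scope.

(* Points of R^dim, with the Borel sigma-algebra of the usual topology. *)
Definition euclid (R : realType) (dim : nat) : measurableType _ :=
  g_sigma_algebraType (@open 'rV[R]_dim).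

Section Euclid.
Context {R : realType} {dim : nat}.
Local Notation T := (euclid R dim).
Implicit Types (Omega A U : set T) (x y : T).

Definition coordinate x (i : 'I_dim) : R := (x : 'rV[R]_dim) ord0 i.

Definition eucl_dist x y : R :=
  Num.sqrt (\sum_(i < dim) (coordinate x i - coordinate y i) ^+ 2).

Definition diameter U : \bar R :=
  maxe 0%E (ereal_sup [set (eucl_dist u.1 u.2)%:E | u in U `*` U]).

(* k-dimensional Hausdorff outer measure, without normalizing constant. *)
Definition hausdorff (k : nat) A : \bar R :=
  ereal_sup [set ereal_inf
      [set (\sum_(0 <= i <oo) (diameter (U i)) ^+ k)%E | U in
        [set U : nat -> set T | A `<=` \bigcup_i U i /\
                                forall i, (diameter (U i) <= e%:E)%E]]
    | e in [set e : R | 0 < e]].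

Definition poly_eval (p : mpoly dim R) x : R :=
  meval (coordinate x) p.

(* Lebesgue measure of R^dim is determined by its values on boxes. *)
Definition is_lebesgue (l : {measure set T -> \bar R}) : Prop :=
  forall a b : 'I_dim -> R, (forall i, a i <= b i) ->
    l [set x | forall i, a i <= coordinate x i <= b i] =
    (\prod_(i < dim) (b i - a i))%:E.

(* The natural measure m on Omega: Lebesgue measure if Omega has nonempty
   interior, and the k-dimensional surface measure (a constant multiple of the
   Hausdorff measure) if Omega is a k-dimensional algebraic surface, or a
   portion of one. *)
Definition lebesgue_on Omega (m : {measure set T -> \bar R}) : Prop :=
  ((interior (Omega : set 'rV[R]_dim)) !=set0 /\
   exists2 l : {measure set T -> \bar R}, is_lebesgue l &
     forall A, measurable A -> A `<=` Omega -> m A = l A)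
  \/
  ((exists2 g : mpoly dim R, g != 0 &
      forall x, Omega x -> poly_eval g x = 0) /\
   exists k : nat, (0 < k < dim)%N /\
   exists2 c : R, 0 < c &
     forall A, measurable A -> A `<=` Omega -> m A = (c%:E * hausdorff k A)%E).

(* d is a metric on Omega inducing the topology that Omega has in R^dim. *)
Definition metric_on Omega (d : T -> T -> R) : Prop :=
  [/\ forall x y, Omega x -> Omega y -> 0 <= d x y,
      forall x y, Omega x -> Omega y -> (d x y = 0 <-> x = y),
      forall x y, Omega x -> Omega y -> d x y = d y x,
      forall x y z, Omega x -> Omega y -> Omega z -> d x z <= d x y + d y z &
      forall x, Omega x -> forall e, 0 < e ->
        (exists2 e', 0 < e' & forall y, Omega y -> eucl_dist x y < e' -> d x y < e)
        /\
        (exists2 e', 0 < e' & forall y, Omega y -> d x y < e' -> eucl_dist x y < e)].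

Definition dball Omega (d : T -> T -> R) x (r : R) : set T :=
  [set y | Omega y /\ d x y < r].

Definition doubling_measure Omega d (m : {measure set T -> \bar R}) : Prop :=
  exists2 c : R, 0 < c & forall x r, Omega x -> 0 < r ->
    (m (dball Omega d x (2 * r)) <= c%:E * m (dball Omega d x r))%E.

Definition balls_bounded_below Omega d (m : {measure set T -> \bar R}) : Prop :=
  forall e : R, 0 < e -> exists2 c : R, 0 < c &
    forall x, Omega x -> (c%:E <= m (dball Omega d x e))%E.

(* Functions on Omega are total functions on R^dim whose values outside Omega
   are irrelevant. The bound on [mmeasure mdeg], which is the total degree plus
   one, says that the degree is at most n. *)
Definition Pi Omega (n : nat) : set (T -> R) :=
  [set f | exists2 p : mpoly dim R,
     (mmeasure mdeg p <= n.+1)%N &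
     forall x, Omega x -> f x = poly_eval p x].

Section Weighted.
Variables (Omega : set T) (m : {measure set T -> \bar R}) (d : T -> T -> R).
Implicit Types (w f g : T -> R) (a : R -> R).

Definition weight w : Prop :=
  (forall x, Omega x -> 0 <= w x) /\ m.-integrable Omega (EFin \o w).

Definition wmeas w (E : set T) : R := \int[m]_(x in E) w x.

Definition doubling_weight w : Prop :=
  weight w /\
  exists2 L : R, 0 < L & forall x r, Omega x -> 0 < r ->
    wmeas w (dball Omega d x (2 * r)) <= L * wmeas w (dball Omega d x r).

Definition inner w f g : R := \int[m]_(x in Omega) (f x * g x * w x).

Definition norm2 w f : \bar R :=
  sqrte (\int[m]_(x in Omega) (f x ^+ 2 * w x)%:E)%E.

Definition L2 w : set (T -> R) :=
  [set f | measurable_fun Omega f /\ (norm2 w f < +oo)%E].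

(* Orthogonality to Pi_{n-1}, with Pi_{-1} = 0. *)
Definition Vspace w (n : nat) : set (T -> R) :=
  [set f | Pi Omega n f /\
     forall k, (k < n)%N -> forall g, Pi Omega k g -> inner w f g = 0].

Definition reproducing_kernel w (n : nat) : set (T -> T -> R) :=
  [set K | (forall x, Omega x -> Vspace w n (K x)) /\
     forall f, Vspace w n f -> forall x, Omega x -> f x = inner w f (K x)].

(* The reproducing kernel is unique on Omega x Omega. *)
Definition Pkernel w (n : nat) : T -> T -> R :=
  xget (fun _ _ => 0) (reproducing_kernel w n).

Definition smooth a : Prop := forall k t, derivable (derive1n k a) t 1.

(* In type (a), a is considered on [0, +oo[ only. *)
Definition cutoff_a a : Prop :=
  [/\ smooth a, forall t, 0 <= a t,
      closure [set t | 0 <= t /\ a t != 0] `<=` `[0, 2] &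
      forall t, 0 <= t <= 1 -> a t = 1].

Definition cutoff_b a : Prop :=
  [/\ smooth a, forall t, 0 <= a t &
      closure [set t | a t != 0] `<=` `[2^-1, 2]].

Definition admissible a : Prop := cutoff_a a \/ cutoff_b a.

Definition Lkernel a w (n : nat) x y : R :=
  limn (fun N => \sum_(0 <= k < N) a (k%:R / n%:R) * Pkernel w k x y).

Definition assertion1 w : Prop :=
  forall a, admissible a -> forall kappa : R, 0 < kappa ->
  exists c : R, forall (n : nat) x y, (0 < n)%N -> Omega x -> Omega y ->
    `|Lkernel a w n x y| <=
    c / (Num.sqrt (wmeas w (dball Omega d x n%:R^-1)) *
         Num.sqrt (wmeas w (dball Omega d y n%:R^-1)) *
         (1 + n%:R * d x y) `^ kappa).

Definition assertion2 w : Prop :=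
  forall a, admissible a -> exists2 delta0 : R, 0 < delta0 < 1 &
  forall kappa : R, 0 < kappa ->
  exists c : R, forall (delta : R) (n : nat) x1 x2 y,
    0 < delta <= delta0 -> (0 < n)%N -> Omega x2 -> Omega y ->
    dball Omega d x2 (delta / n%:R) x1 ->
    `|Lkernel a w n x1 y - Lkernel a w n x2 y| <=
    c * n%:R * d x1 x2 /
      (Num.sqrt (wmeas w (dball Omega d x1 n%:R^-1)) *
       Num.sqrt (wmeas w (dball Omega d x2 n%:R^-1)) *
       (1 + n%:R * d x2 y) `^ kappa).

Definition assertion3 w : Prop :=
  exists kappa0 : R, forall kappa : R, kappa0 <= kappa -> 0 < kappa ->
  exists c : R, forall (n : nat) x, (0 < n)%N -> Omega x ->
    (\int[m]_(y in Omega)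
       (w y / (wmeas w (dball Omega d y n%:R^-1) *
               (1 + n%:R * d x y) `^ kappa))%:E <= c%:E)%E.

Definition assertion4 : Prop :=
  compact (Omega : set 'rV[R]_dim) /\
  exists (delta' c1 c2 : R) (c : R -> R) (r : nat),
    [/\ 0 < delta', 0 < c1, 0 < c2 & (0 < r)%N] /\
    forall n : nat, (0 < n)%N ->
    exists (Tx : T -> T -> R) (q : T -> R),
      (forall x, Omega x ->
         [/\ Pi Omega n (Tx x), Tx x x = 1,
             forall y, dball Omega d x n%:R^-1 y -> delta' <= Tx x y &
             forall gamma y, 1 < gamma -> Omega y ->
               0 <= Tx x y <= c gamma * (1 + n%:R * d x y) `^ (- gamma)]) /\
      [/\ exists k, Pi Omega k q,
          forall y, Omega y -> Pi Omega (r * n) (fun x => q x * Tx x y) &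
          forall x, Omega x -> c1 <= q x <= c2].

Definition localizable w : Prop :=
  [/\ doubling_weight w, wmeas w Omega = 1,
      assertion1 w, assertion2 w & assertion3 w].

Definition separated (e : R) (Xi : set T) : Prop :=
  Xi `<=` Omega /\ forall x y, Xi x -> Xi y -> x <> y -> e <= d x y.

Definition maximal_separated (cd e : R) (Xi : set T) : Prop :=
  separated e Xi /\ forall x, Omega x ->
    1 <= \sum_(z \in Xi) (\1_(dball Omega d z e) x : R) <= cd.

Definition Fkernel a w (j : nat) x z : R :=
  if j is i.+1 then Lkernel a w (2 ^ i)%N x z else 1.

Definition frame a w (lambda : nat -> T -> R) (j : nat) (z x : T) : R :=
  Num.sqrt (lambda j z) * Fkernel a w j x z.

End Weighted.

End Euclid.

(* Main.v *)
(* Let v_k be the component of f in V_k. Since F_j(x, .) = sum_k c_jk P_k(x, .)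
   with c_jk = a(k / 2^(j-1)) for j > 0, reproduction gives
   <f, F_j(., z)> = sum_k c_jk v_k(z), a polynomial in z. The cubature on
   products of two such sums then turns level j of the frame expansion into
   sum_k c_jk^2 v_k, and level j of the energy into sum_k c_jk^2 |v_k|^2. The
   condition a(t)^2 + a(2t)^2 = 1 makes the partial sums over j of c_jk^2 lie in
   [0, 1] and be eventually 1, so both claims follow from the density of
   polynomials in L^2(w). Kernels exist and are determined on Omega because a
   doubling weight charges every ball, so that <p, p> = 0 forces p = 0. *)
Require Import Defs.
From mathcomp Require Import all_boot all_order all_algebra.
From mathcomp Require Import all_classical all_reals all_analysis.
From mathcomp Require Import measurable_realfun ring lra.
From mathcomp Require mpoly.
Import -(notations) mpoly.
Set Implicit Arguments.
Unset Strict Implicit.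
Unset Printing Implicit Defensive.
Import Order.TTheory GRing.Theory Num.Theory numFieldNormedType.Exports.
Import HBNNSimple.
Local Open Scope classical_set_scope.
Local Open Scope ring_scope.

(** * Polynomial functions *)

Section PolynomialFunctions.
Context {R : realType} {dim : nat}.
Local Notation T := (euclid R dim).
Implicit Types (Omega : set T) (f g : T -> R).

(** Both claims come down to one scalar limit. For weights b_k, orthogonality gives |f - sum_k b_k
    v_k|^2 = |f|^2 - sum_k (2 b_k - b_k^2) |v_k|^2, and b <= 2b - b^2 on [0, 1]. Hence the squared
    error of a partial sum lies between 0 and |f|^2 - sum_k b_k |v_k|^2, where the subtracted sum is
    exactly the partial energy. Each level is a finite sum because [a] vanishes from 2 on, so only
    finite sums are ever interchanged. The domain may lie on a surface, where monomials can be
    linearly dependent as functions. Gram-Schmidt therefore starts from a spanning list and drops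
    what is dependent, and functions are compared on [Omega] only. Density rests on pointwise limits
    of polynomials with values in [0, 1], to which dominated convergence applies. *)

Lemma eq_Pi Omega n f g : (forall x, Omega x -> f x = g x) ->
  Pi Omega n g -> Pi Omega n f.
Proof. by move=> fg [p sp gp]; exists p => // x Ox; rewrite fg// gp. Qed.

Lemma Pi_leq Omega n k f : (n <= k)%N -> Pi Omega n f -> Pi Omega k f.
Proof. by move=> nk [p sp fp]; exists p => //; apply: leq_trans sp _. Qed.

Lemma Pi_cst Omega n (c : R) : Pi Omega n (fun=> c).
Proof.
exists (mpolyC dim c); first by rewrite mmeasureC; case: eqP.
by move=> x _; rewrite /poly_eval mevalC.
Qed.

Lemma Pi_coordinate Omega (i : 'I_dim) : Pi Omega 1 (fun x => coordinate x i).
Proof.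
exists (mpolyX R (mnm1 i)); first by rewrite msizeX mdeg1.
by move=> x _; rewrite /poly_eval mevalXU.
Qed.

Lemma PiD Omega n f g :
  Pi Omega n f -> Pi Omega n g -> Pi Omega n (fun x => f x + g x).
Proof.
move=> [p sp fp] [q sq gq]; exists (p + q).
  by rewrite (leq_trans (mmeasureD_le _ _ _))// geq_max sp.
by move=> x Ox; rewrite /poly_eval mevalD fp// gq.
Qed.

Lemma PiM Omega n k f g :
  Pi Omega n f -> Pi Omega k g -> Pi Omega (n + k) (fun x => f x * g x).
Proof.
move=> [p sp fp] [q sq gq]; exists (p * q); last first.
  by move=> x Ox; rewrite /poly_eval mevalM fp// gq.
have [->|p0] := eqVneq p 0; first by rewrite mul0r mmeasure0.
have [->|q0] := eqVneq q 0; first by rewrite mulr0 mmeasure0.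
rewrite msizeM// -subn1 leq_subLR (leq_trans (leq_add sp sq))//.
by rewrite addSn addnS add1n.
Qed.

Lemma PiZ Omega n (c : R) f : Pi Omega n f -> Pi Omega n (fun x => c * f x).
Proof. by move=> Pf; have := PiM (Pi_cst Omega 0 c) Pf. Qed.

Lemma Pi_sum Omega n (I : Type) (s : seq I) (P : pred I) (F : I -> T -> R) :
  (forall i, P i -> Pi Omega n (F i)) ->
  Pi Omega n (fun x => \sum_(i <- s | P i) F i x).
Proof.
move=> PF; elim: s => [|i s IH].
  by apply: eq_Pi (Pi_cst Omega n 0) => x _; rewrite big_nil.
case Pi: (P i).
  by apply: eq_Pi (PiD (PF i Pi) IH) => x _; rewrite big_cons Pi.
by apply: eq_Pi IH => x _; rewrite big_cons Pi.
Qed.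

Lemma PiX Omega n k f : Pi Omega n f -> Pi Omega (n * k) (fun x => f x ^+ k).
Proof.
move=> Pf; elim: k => [|k IH].
  by apply: eq_Pi (Pi_cst Omega _ 1) => x _; rewrite expr0.
by rewrite mulnS; apply: eq_Pi (PiM Pf IH) => x _; rewrite exprS.
Qed.

(** The list consists of the monomials of degree at most n. On an algebraic surface they may be
    dependent, so the coefficients need not be unique. *)
Lemma Pi_span Omega n : exists2 s : seq (T -> R),
  (forall g, g \in s -> Pi Omega n g) &
  forall f, Pi Omega n f -> exists c : nat -> R,
    forall x, Omega x -> f x = \sum_(i < size s) c i * nth (fun=> 0) s i x.
Proof.
pose I : finType := bmultinom dim n.+1.
pose mon (i : I) : T -> R := poly_eval (mpolyX R (val i)).
exists [seq mon i | i : I].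
  move=> g /mapP[i _ ->]; exists (mpolyX R (val i)) => //.
  by rewrite msizeX; exact: (valP i).
move=> f [p sp fp].
exists (fun k => if insub k : option 'I_#|I| is Some i
  then mcoeff (val (enum_val i)) p else 0) => x Ox.
rewrite fp// {1}/poly_eval (mpolywE sp) raddf_sum/=.
rewrite size_map -cardE (reindex_onto (@enum_val I predT) (@enum_rank I))/=; last first.
  by move=> i _; rewrite enum_rankK.
apply: eq_big => [i|i _]; first by rewrite enum_valK eqxx.
rewrite mevalZ valK; congr (_ * _); first by rewrite -mpolywE.
by rewrite /image_mem (nth_map (enum_val i)) -?cardE// -enum_val_nth.
Qed.

End PolynomialFunctions.

(** * Continuity, measurability, and the balls of [d] *)

Section Topology.
Context {R : realType} {dim : nat}.
Local Notation T := (euclid R dim).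
Local Notation V := 'rV[R]_dim.
Implicit Types (Omega : set T) (f g : T -> R).

Lemma poly_eval_continuous (p : mpoly dim R) :
  continuous (poly_eval p : V -> R).
Proof.
have -> : (poly_eval p : V -> R) = fun x : V => \sum_(m <- msupp p)
    mcoeff m p * \prod_(i < dim) (coordinate x i) ^+ m i.
  by apply/funext => x; rewrite /poly_eval mevalE.
apply: continuous_big => [|m _]; first exact: add_continuous.
move=> x; apply: continuousM; first exact: cst_continuous.
move: x; apply: continuous_big => [|i _ x]; first exact: mul_continuous.
apply: (@continuous_comp _ _ _ (fun y : V => coordinate y i)
  (fun r => r ^+ m i)); first exact: coord_continuous.
exact: exprn_continuous.
Qed.

Lemma open_euclid_measurable (A : set V) :
  open A -> measurable (A : set T).
Proof. exact: sub_gen_smallest. Qed.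

Lemma continuous_euclid_measurable (f : T -> R) :
  continuous (f : V -> R) -> measurable_fun setT f.
Proof.
move=> /continuousP cf; apply: (measurability _ (RGenOpens.measurableE R)).
move=> _ [_ [a [b ->] <-]]; rewrite setTI; apply: open_euclid_measurable.
exact/cf/interval_open.
Qed.

Lemma compact_euclid_measurable (A : set V) :
  compact A -> measurable (A : set T).
Proof.
move=> cA; rewrite -(setCK A); apply: measurableC; apply: open_euclid_measurable.
by apply: closed_openC; apply: compact_closed => //; exact: norm_hausdorff.
Qed.

Lemma poly_eval_measurable (p : mpoly dim R) (D : set T) :
  measurable D -> measurable_fun D (poly_eval p : T -> R).
Proof.
move=> mD; apply: (measurable_funS measurableT) => //.
apply: continuous_euclid_measurable; exact: poly_eval_continuous.
Qed.

Lemma Pi_measurable Omega n f :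
  measurable Omega -> Pi Omega n f -> measurable_fun Omega f.
Proof.
move=> mO [p _ fp]; apply: (@eq_measurable_fun _ _ _ _ Omega (poly_eval p) f).
  by move=> x; rewrite inE => Ox; rewrite fp.
exact: poly_eval_measurable.
Qed.

Lemma Pi_bounded Omega n f : compact (Omega : set V) -> Pi Omega n f ->
  exists2 M : R, 0 < M & forall x, Omega x -> `|f x| <= M.
Proof.
move=> cO [p _ fp].
have /compact_bounded [M [_ HM]] : compact ((poly_eval p : V -> R) @` Omega).
  apply: continuous_compact => //; apply: continuous_subspaceT.
  exact: poly_eval_continuous.
exists (Num.max M 0 + 1) => [|x Ox].
  by rewrite ltr_wpDl// le_max lexx orbT.
rewrite fp//; apply: HM; last by exists x.
by rewrite ltr_pwDr// le_max lexx.
Qed.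

Lemma eucl_dist_ball_open (x : T) (e : R) :
  open ([set y : V | eucl_dist x y < e] : set V).
Proof.
have [e0|e0] := ltP 0 e; last first.
  rewrite (_ : [set _ | _] = set0); first exact: open0.
  apply/seteqP; split => // y /=; apply/negP; rewrite -leNgt.
  exact: le_trans e0 (sqrtr_ge0 _).
pose q (y : V) := \sum_(i < dim) (coordinate x i - coordinate y i) ^+ 2.
have cq : continuous q.
  apply: continuous_big => [|i _ y]; first exact: add_continuous.
  apply: (@continuous_comp _ _ _ (fun y : V => coordinate x i - coordinate y i)
    (fun r => r ^+ 2)); last exact: exprn_continuous.
  by apply: continuousB; [exact: cst_continuous|exact: coord_continuous].
rewrite (_ : [set _ | _] = q @^-1` [set r | r < e ^+ 2]); last first.
  by apply/funext => y /=; rewrite -(ltr_sqrt (q y)) ?exprn_gt0// sqrtr_sqr gtr0_norm.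
move/continuousP : cq; apply; exact: open_lt.
Qed.

Lemma eucl_dist_ge_coordinate (x y : T) i :
  `|coordinate x i - coordinate y i| <= eucl_dist x y.
Proof.
rewrite -sqrtr_sqr ler_wsqrtr// (bigD1 i)//= lerDl.
by apply: sumr_ge0 => j _; exact: sqr_ge0.
Qed.

(** The metric [d] is compared with the Euclidean one on [Omega] only, so a [d]-ball need not be
    open in R^dim. It is the trace on [Omega] of a union of Euclidean balls. *)
Lemma dball_measurable Omega d x r : measurable Omega -> metric_on Omega d ->
  Omega x -> measurable (dball Omega d x r).
Proof.
move=> mO [d0 d1 dC dT dtop] Ox.
pose U : set V := \bigcup_(i in [set i : V * R | Omega i.1 /\
  forall z, Omega z -> eucl_dist i.1 z < i.2 -> d x z < r])
    [set z : V | eucl_dist i.1 z < i.2].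
rewrite (_ : dball _ _ _ _ = Omega `&` U).
  apply: measurableI => //; apply: open_euclid_measurable.
  by apply: bigcup_open => -[y e] _; exact: eucl_dist_ball_open.
apply/seteqP; split => y [Oy] => [dxy|].
  split => //; have [|[e' e'0 he'] _] := dtop y Oy (r - d x y).
    by rewrite subr_gt0.
  exists (y, e') => /=; first split => // z Oz yz.
    rewrite (le_lt_trans (dT x y z Ox Oy Oz))// -ltrBrDl.
    exact: he'.
  rewrite /eucl_dist big1 ?sqrtr0// => i _.
  by rewrite subrr expr0n.
by move=> [[z e]] /= [Oz H] ze; split => //; exact: H.
Qed.

(** By continuity f^2 stays above half of its value at x on a sup-norm ball; the topological clause
    of [metric_on] fits a [d]-ball inside it. *)
Lemma Pi_neq0_dball Omega d n f x : metric_on Omega d -> Pi Omega n f ->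
  Omega x -> f x != 0 ->
  exists r c : R, [/\ 0 < r, 0 < c &
    forall y, dball Omega d x r y -> c <= f y ^+ 2].
Proof.
move=> [_ _ _ _ dtop] [p _ fp] Ox fx0.
pose g (y : V) := poly_eval p y ^+ 2.
have cg : continuous g.
  move=> y; apply: (@continuous_comp _ _ _ (poly_eval p : V -> R)
    (fun r => r ^+ 2)); by [exact: poly_eval_continuous|exact: exprn_continuous].
have gx0 : 0 < g x by rewrite /g -fp// lt_def sqr_ge0 sqrf_eq0 fx0.
have : nbhs (x : V) [set y | g x / 2 < g y].
  have /continuousP /(_ [set r | g x / 2 < r]) ho := cg.
  apply: open_nbhs_nbhs; split; first by apply: ho; exact: open_gt.
  by rewrite /=; lra.
move=> /nbhs_ballP[e /= e0 he].
have [_ [r r0 hr]] := dtop x Ox e e0.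
exists r, (g x / 2); split => //; first by lra.
move=> y [Oy dxy]; rewrite fp// ltW//; apply: he.
split => // i j; rewrite (ord1 i) /ball/=.
exact: le_lt_trans (eucl_dist_ge_coordinate x y j) (hr y Oy dxy).
Qed.

End Topology.

(** * The inner product of a weight *)

Section WeightedL2.
Context {R : realType} {dim : nat}.
Local Notation T := (euclid R dim).
Variables (Omega : set T) (m : {measure set T -> \bar R}) (w : T -> R).
Hypothesis Omega_measurable : measurable Omega.
Hypothesis w_weight : weight Omega m w.
Implicit Types (f g h : T -> R).

(** Real-valued integrals are linear only on integrable functions, so membership in L^2 is recast as
    integrability of f^2 w. [L2_square_integrable] is the bridge from the extended norm. *)
Definition square_integrable : set (T -> R) :=
  [set f : T -> R | measurable_fun Omega f /\
           m.-integrable Omega (EFin \o (fun x => f x ^+ 2 * w x))].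

Local Notation sqint := square_integrable.
Local Notation "<< f , g >>" := (inner Omega m w f g).

Lemma weight_ge0 x : Omega x -> 0 <= w x.
Proof. by case: w_weight => + _; exact. Qed.

Lemma weight_measurable : measurable_fun Omega w.
Proof. by case: w_weight => _ /measurable_int /measurable_EFinP. Qed.

Lemma integrable_le_real f g :
  measurable_fun Omega f -> m.-integrable Omega (EFin \o g) ->
  (forall x, Omega x -> `|f x| <= g x) -> m.-integrable Omega (EFin \o f).
Proof.
move=> mf ig fg; apply: le_integrable ig => //; first exact/measurable_EFinP.
move=> x Ox; rewrite /= lee_fin (le_trans (fg x Ox))//.
exact: ler_norm.
Qed.

Lemma integrableD_real f g :
  m.-integrable Omega (EFin \o f) -> m.-integrable Omega (EFin \o g) ->
  m.-integrable Omega (EFin \o (fun x => f x + g x)).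
Proof.
move=> i1 i2.
by apply: eq_integrable (integrableD Omega_measurable i1 i2) => // x _; rewrite /= EFinD.
Qed.

Lemma integrableZ_real (c : R) f :
  m.-integrable Omega (EFin \o f) ->
  m.-integrable Omega (EFin \o (fun x => c * f x)).
Proof.
move=> i1.
by apply: eq_integrable (integrableZl Omega_measurable c i1) => // x _; rewrite /= EFinM.
Qed.

(** Domination by (f^2 + g^2) w, since |f g| <= f^2 + g^2. *)
Lemma square_integrable_mul f g : sqint f -> sqint g ->
  m.-integrable Omega (EFin \o (fun x => f x * g x * w x)).
Proof.
move=> [mf f2] [mg g2]; have mw := weight_measurable.
apply: integrable_le_real (integrableD_real f2 g2) _.
  by apply: measurable_funM => //; exact: measurable_funM.
move=> x Ox; have w0 := weight_ge0 Ox.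
rewrite -mulrDl normrM (ger0_norm w0) ler_wpM2r// ler_norml.
by apply/andP; split; nra.
Qed.

Lemma square_integrableZ c f : sqint f -> sqint (fun x => c * f x).
Proof.
move=> [mf f2]; split; first exact: measurable_funM.
by apply: eq_integrable (integrableZ_real (c ^+ 2) f2) => // x _; rewrite /= exprMn mulrA.
Qed.

Lemma square_integrableD f g : sqint f -> sqint g -> sqint (fun x => f x + g x).
Proof.
move=> sf sg; have [mf f2] := sf; have [mg g2] := sg.
split; first exact: measurable_funD.
have fg := square_integrable_mul sf sg.
apply: eq_integrable (integrableD_real (integrableD_real f2 g2)
  (integrableZ_real 2 fg)) => // x _ /=; congr EFin; ring.
Qed.

Lemma square_integrableB f g : sqint f -> sqint g -> sqint (fun x => f x - g x).
Proof.
move=> sf sg; have := square_integrableD sf (square_integrableZ (-1) sg).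
by under eq_fun do rewrite mulN1r.
Qed.

Lemma bounded_square_integrable f (M : R) : measurable_fun Omega f ->
  (forall x, Omega x -> `|f x| <= M) -> sqint f.
Proof.
move=> mf fM; split => //; case: (w_weight) => w0 iw.
apply: integrable_le_real (integrableZ_real (M ^+ 2) iw) _.
  by apply: measurable_funM; [exact: measurable_funX|exact: weight_measurable].
move=> x Ox; have M0 := le_trans (normr_ge0 _) (fM x Ox).
rewrite ger0_norm; last by apply: mulr_ge0; [exact: sqr_ge0|exact: w0].
rewrite ler_wpM2r ?w0// -(real_normK (num_real (f x))).
by rewrite lerXn2r ?nnegrE// fM.
Qed.

Lemma square_integrable_sum (I : Type) (s : seq I) (P : pred I) (F : I -> T -> R) :
  (forall i, P i -> sqint (F i)) -> sqint (fun x => \sum_(i <- s | P i) F i x).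
Proof.
move=> sF; elim: s => [|i s IH].
  rewrite (_ : (fun _ => _) = fun=> 0); last by apply/funext => x; rewrite big_nil.
  by apply: (bounded_square_integrable (M := 0)) => // x _; rewrite normr0.
under eq_fun do rewrite big_cons.
by case Pi: (P i) => //; apply: square_integrableD => //; exact: sF.
Qed.

Lemma eq_inner f f' g g' : (forall x, Omega x -> f x = f' x) ->
  (forall x, Omega x -> g x = g' x) -> << f, g >> = << f', g' >>.
Proof.
by move=> ff gg; apply: eq_Rintegral => x /set_mem Ox; rewrite ff// gg.
Qed.

Lemma innerC f g : << f, g >> = << g, f >>.
Proof. by apply: eq_Rintegral => x _; rewrite (mulrC (f x)). Qed.

Lemma innerDl f g h : sqint f -> sqint g -> sqint h ->
  << (fun x => f x + g x), h >> = << f, h >> + << g, h >>.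
Proof.
move=> sf sg sh; rewrite /inner -RintegralD//; try exact: square_integrable_mul.
by apply: eq_Rintegral => x _; rewrite !mulrDl.
Qed.

Lemma innerZl c f h : sqint f -> sqint h ->
  << (fun x => c * f x), h >> = c * << f, h >>.
Proof.
move=> sf sh; rewrite /inner -RintegralZl//; last exact: square_integrable_mul.
by apply: eq_Rintegral => x _; rewrite !mulrA.
Qed.

Lemma innerBl f g h : sqint f -> sqint g -> sqint h ->
  << (fun x => f x - g x), h >> = << f, h >> - << g, h >>.
Proof.
move=> sf sg sh; rewrite -mulN1r -innerZl// -innerDl//; last exact: square_integrableZ.
by apply: eq_inner => // x _; rewrite mulN1r.
Qed.

Lemma inner0l h : << (fun=> 0), h >> = 0.
Proof.
rewrite /inner; under eq_Rintegral do rewrite mul0r mul0r.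
by rewrite Rintegral_cst// mul0r.
Qed.

Lemma inner_suml (I : Type) (s : seq I) (P : pred I) (F : I -> T -> R) h :
  (forall i, P i -> sqint (F i)) -> sqint h ->
  << (fun x => \sum_(i <- s | P i) F i x), h >> = \sum_(i <- s | P i) << F i, h >>.
Proof.
move=> sF sh; elim: s => [|i s IH].
  by rewrite [RHS]big_nil -[RHS](inner0l h); apply: eq_inner => // x _; rewrite big_nil.
rewrite big_cons -IH; case: ifPn => Pi; last first.
  by apply: eq_inner => // x _; rewrite big_cons (negbTE Pi).
rewrite -innerDl//; [|exact: sF|exact: square_integrable_sum].
by apply: eq_inner => // x _; rewrite big_cons Pi.
Qed.

Lemma innerDr f g h : sqint f -> sqint g -> sqint h ->
  << h, (fun x => f x + g x) >> = << h, f >> + << h, g >>.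
Proof. by move=> *; rewrite innerC innerDl// !(innerC h). Qed.

Lemma innerBr f g h : sqint f -> sqint g -> sqint h ->
  << h, (fun x => f x - g x) >> = << h, f >> - << h, g >>.
Proof. by move=> *; rewrite innerC innerBl// !(innerC h). Qed.

Lemma innerZr c f h : sqint f -> sqint h ->
  << h, (fun x => c * f x) >> = c * << h, f >>.
Proof. by move=> *; rewrite innerC innerZl// !(innerC h). Qed.

Lemma inner_sumr (I : Type) (s : seq I) (P : pred I) (F : I -> T -> R) h :
  (forall i, P i -> sqint (F i)) -> sqint h ->
  << h, (fun x => \sum_(i <- s | P i) F i x) >> = \sum_(i <- s | P i) << h, F i >>.
Proof.
by move=> *; rewrite innerC inner_suml//; apply: eq_bigr => *; rewrite innerC.
Qed.

Lemma inner_ge0 f : 0 <= << f, f >>.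
Proof.
by apply: Rintegral_ge0 => x Ox; rewrite mulr_ge0 ?weight_ge0// -expr2 sqr_ge0.
Qed.

Lemma square_integral_inner f : sqint f ->
  (\int[m]_(x in Omega) (f x ^+ 2 * w x)%:E)%E = (<< f, f >>)%:E.
Proof.
move=> sf; rewrite /inner /Rintegral fineK.
  by apply: eq_integral => x _; rewrite expr2.
exact: integrable_fin_num (square_integrable_mul sf sf).
Qed.

Lemma norm2_inner f : sqint f -> norm2 Omega m w f = (Num.sqrt << f, f >>)%:E.
Proof. by move=> sf; rewrite /norm2 square_integral_inner. Qed.

Lemma L2_square_integrable f : L2 Omega m w f -> sqint f.
Proof.
move=> [mf nf]; split => //; apply/integrableP; split.
  apply/measurable_EFinP/measurable_funM; last exact: weight_measurable.
  exact: measurable_funX.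
move: nf; rewrite /norm2.
rewrite [X in _ -> (X < _)%E](_ : _ =
  (\int[m]_(x in Omega) (f x ^+ 2 * w x)%:E)%E); last first.
  apply: eq_integral => x /set_mem Ox /=.
  by rewrite ger0_norm// mulr_ge0 ?weight_ge0// sqr_ge0.
by case: (\int[m]_(x in Omega) _)%E => [r _| |_]; rewrite ?ltry ?ltNyr.
Qed.

Lemma inner_sqB f g : sqint f -> sqint g ->
  << (fun x => f x - g x), (fun x => f x - g x) >> =
  << f, f >> - 2 * << f, g >> + << g, g >>.
Proof.
move=> sf sg; have sfg := square_integrableB sf sg.
rewrite innerBl// !innerBr// (innerC g f); ring.
Qed.

Lemma inner_sqD f g : sqint f -> sqint g ->
  << (fun x => f x + g x), (fun x => f x + g x) >> =
  << f, f >> + 2 * << f, g >> + << g, g >>.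
Proof.
move=> sf sg; have sfg := square_integrableD sf sg.
rewrite innerDl// !innerDr// (innerC g f); ring.
Qed.

(** By the parallelogram law the gap is <f - g, f - g>. For squared distances this serves as the
    triangle inequality. *)
Lemma inner_sqD_le f g : sqint f -> sqint g ->
  << (fun x => f x + g x), (fun x => f x + g x) >> <= 2 * << f, f >> + 2 * << g, g >>.
Proof.
move=> sf sg; have := inner_ge0 (fun x => f x - g x).
rewrite inner_sqB// inner_sqD//; lra.
Qed.

(** For an orthonormal [E] this is the orthogonal projection onto the span of [E]. *)
Definition expansion (E : seq (T -> R)) f x := \sum_(e <- E) << f, e >> * e x.

Lemma expansion_Pi n E f : (forall e, e \in E -> Pi Omega n e) ->
  Pi Omega n (expansion E f).
Proof.
move=> PE; rewrite /expansion; under eq_fun do rewrite big_seq.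
by apply: Pi_sum => e /PE; exact: PiZ.
Qed.

Lemma expansion_inner E f g : (forall e, e \in E -> sqint e) -> sqint g ->
  << expansion E f, g >> = \sum_(e <- E) << f, e >> * << e, g >>.
Proof.
move=> sE sg; rewrite /expansion; under eq_fun do rewrite big_seq.
rewrite inner_suml// => [|e /sE se]; last exact: square_integrableZ.
by rewrite [RHS]big_seq; apply: eq_bigr => e /sE se; rewrite innerZl.
Qed.

(** Both sides equal sum_e <f, e> <e, g>, which is symmetric in f and g for any [E]. *)
Lemma expansion_adjoint E f g : (forall e, e \in E -> sqint e) ->
  sqint f -> sqint g -> << expansion E f, g >> = << f, expansion E g >>.
Proof.
move=> sE sf sg; rewrite [RHS]innerC !expansion_inner//.
by apply: eq_bigr => e _; rewrite (innerC e g) (innerC e f) mulrC.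
Qed.

Lemma Pi_square_integrable n f :
  compact (Omega : set 'rV[R]_dim) -> Pi Omega n f -> sqint f.
Proof.
move=> cO Pf; have [M _ fM] := Pi_bounded cO Pf.
by apply: bounded_square_integrable fM => //; exact: Pi_measurable Pf.
Qed.

End WeightedL2.

(** * Balls have positive mass *)

Section DoublingWeight.
Context {R : realType} {dim : nat}.
Local Notation T := (euclid R dim).
Variables (Omega : set T) (m : {measure set T -> \bar R}) (d : T -> T -> R).
Variable w : T -> R.
Hypothesis Omega_measurable : measurable Omega.
Hypothesis d_metric : metric_on Omega d.
Hypothesis w_doubling : doubling_weight Omega m d w.
Hypothesis w_unit : wmeas m w Omega = 1.

Let w_weight : weight Omega m w. Proof. by case: w_doubling. Qed.

Lemma wmeas_integral (D : set T) : measurable D -> D `<=` Omega ->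
  (wmeas m w D)%:E = (\int[m]_(x in D) (w x)%:E)%E.
Proof.
move=> mD DO; rewrite /wmeas /Rintegral fineK//.
apply: integrable_fin_num => //; case: w_weight => _.
exact: integrableS.
Qed.

(* A null ball would have null dilates, which exhaust Omega. *)
Lemma dball_wmeas_gt0 x r : Omega x -> 0 < r -> 0 < wmeas m w (dball Omega d x r).
Proof.
move=> Ox r0; have w0 := weight_ge0 w_weight.
have W0 s : 0 <= wmeas m w (dball Omega d x s).
  by apply: Rintegral_ge0 => y [Oy _]; exact: w0.
rewrite lt_def W0 andbT; apply/eqP => W.
have [_ [L L0 HL]] := w_doubling.
pose F k := dball Omega d x (2 ^+ k * r).
have FO k : F k `<=` Omega by move=> y [].
have mF k : measurable (F k) by exact: dball_measurable.
have WF k : wmeas m w (F k) = 0.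
  elim: k => [|k IH]; first by rewrite /F expr0 mul1r.
  apply/eqP; rewrite eq_le W0 andbT.
  have := HL x (2 ^+ k * r) Ox; rewrite mulrA -exprS -/(F k) IH mulr0.
  by apply; rewrite mulr_gt0// exprn_gt0.
have mw := weight_measurable w_weight.
have UF : \bigcup_k F k = Omega.
  apply/seteqP; split => [y [k _ /FO]//|y Oy].
  (* Any k > d x y / r will do, since k < 2^k. *)
  exists (Num.truncn (d x y / r)).+1 => //; split=> //.
  rewrite -ltr_pdivrMr// (lt_le_trans (Num.Theory.truncnS_gt _))//.
  by rewrite -natrX ler_nat ltnW// ltn_expl.
have ndF : nondecreasing_seq F.
  move=> i j ij; apply/subsetPset => y [Oy dxy]; split => //.
  by rewrite (lt_le_trans dxy)// ler_wpM2r ?(ltW r0)// ler_weXn2l// ler1n.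
(* Monotone convergence along the exhausting balls gives the total mass 1, while every term is 0. *)
have : (\int[m]_(x in F i) (w x)%:E @[i --> \oo] --> 1%:E)%E.
  rewrite -w_unit wmeas_integral// -UF; apply: ge0_nondecreasing_set_cvg_integral => //.
  - by move=> i; apply/measurable_EFinP; exact: measurable_funS mw.
  - by move=> i y /FO Oy; rewrite lee_fin w0.
under eq_fun do rewrite -wmeas_integral// WF.
by move=> /(cvg_unique (@ereal_hausdorff R) (cvg_cst 0%:E)) [] /esym /eqP; rewrite oner_eq0.
Qed.

End DoublingWeight.

(** * Orthogonal polynomials *)

Section PolynomialProjections.
Context {R : realType} {dim : nat}.
Local Notation T := (euclid R dim).
Variables (Omega : set T) (m : {measure set T -> \bar R}) (d : T -> T -> R).
Variable w : T -> R.
Hypothesis Omega_compact : compact (Omega : set 'rV[R]_dim).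
Hypothesis d_metric : metric_on Omega d.
Hypothesis w_doubling : doubling_weight Omega m d w.
Hypothesis w_unit : wmeas m w Omega = 1.
Implicit Types (f g h : T -> R) (E : seq (T -> R)).

Local Notation sqint := (square_integrable Omega m w).
Local Notation "<< f , g >>" := (inner Omega m w f g).

Let w_weight : weight Omega m w. Proof. by case: w_doubling. Qed.
Let Omega_measurable : measurable Omega.
Proof. exact: compact_euclid_measurable. Qed.
Hint Resolve w_weight Omega_measurable : core.

Let sqPi n f : Pi Omega n f -> sqint f. Proof. exact: Pi_square_integrable. Qed.

(** If f x were nonzero, f^2 would be at least some c > 0 on a ball B of positive mass, and c w(B)
    <= <f, f>. The conclusion holds at every point of [Omega], not just almost everywhere, as the
    evaluation of kernels and of cubature nodes requires. *)
Lemma Pi_inner_eq0 n f x : Pi Omega n f -> << f, f >> = 0 -> Omega x -> f x = 0.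
Proof.
move=> Pf f0 Ox; apply/eqP/negPn/negP => fx.
have [r [c [r0 c0 fc]]] := Pi_neq0_dball d_metric Pf Ox fx.
have mB : measurable (dball Omega d x r) by exact: dball_measurable.
have BO : dball Omega d x r `<=` Omega by move=> y [].
have mf := Pi_measurable Omega_measurable Pf.
have mw := weight_measurable w_weight.
have mf2w : measurable_fun Omega (fun y => (f y ^+ 2 * w y)%:E).
  by apply/measurable_EFinP; apply: measurable_funM => //; exact: measurable_funX.
have w0 y : Omega y -> 0 <= w y by exact: weight_ge0.
have : (c%:E * (wmeas m w (dball Omega d x r))%:E <= 0%:E)%E.
  rewrite -f0 -square_integral_inner//; last exact: sqPi Pf.
  rewrite (wmeas_integral Omega_measurable w_doubling)// -ge0_integralZl//; last 3 first.
  - by apply/measurable_EFinP; exact: measurable_funS mw.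
  - by move=> y /BO Oy; rewrite lee_fin w0.
  - by rewrite lee_fin ltW.
  apply: (@le_trans _ _ (\int[m]_(y in dball Omega d x r) (f y ^+ 2 * w y)%:E)%E).
    apply: ge0_le_integral => //.
    - by move=> y /BO Oy; rewrite mule_ge0 ?lee_fin ?w0// ltW.
    - by apply/measurable_EFinP; apply: measurable_funM => //; exact: measurable_funS mw.
    - exact: measurable_funS mf2w.
    - by move=> y By; rewrite -EFinM lee_fin ler_wpM2r ?w0 ?fc//; exact: BO.
  apply: ge0_subset_integral => // y Oy.
  by rewrite lee_fin mulr_ge0 ?w0// sqr_ge0.
rewrite -EFinM lee_fin leNgt mulr_gt0//.
exact: (dball_wmeas_gt0 Omega_measurable d_metric w_doubling).
Qed.

(** An orthonormal basis of Pi_n enters the argument only through this identity: [expansion] acts as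
    the identity on Pi_n. *)
Definition orthobasis n : set (seq (T -> R)) :=
  [set E : seq (T -> R) | (forall e, e \in E -> Pi Omega n e) /\
     forall g, Pi Omega n g -> forall x, Omega x -> g x = expansion Omega m w E g x].

(* Orthonormality of E is encoded by e = sum_e' <e, e'> e' for e in E, which
   avoids indexing the basis. *)
Lemma gram_schmidt n (s : seq (T -> R)) : (forall g, g \in s -> Pi Omega n g) ->
  exists E, [/\ forall e, e \in E -> Pi Omega n e,
    forall e, e \in E -> forall x, Omega x -> e x = expansion Omega m w E e x &
    forall g, g \in s -> forall x, Omega x -> g x = expansion Omega m w E g x].
Proof.
elim: s => [|g s IH] Ps; first by exists [::].
have [|E [PE EE sE]] := IH; first by move=> h hs; apply: Ps; rewrite inE hs orbT.
have Pg : Pi Omega n g by apply: Ps; rewrite inE eqxx.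
have sqE e : e \in E -> sqint e by move=> /PE; exact: sqPi.
(* The residual is orthogonal to [E], hence annihilated by the expansion over [E]. *)
pose r x := g x - expansion Omega m w E g x.
have Pp := expansion_Pi m w g PE.
have Pr : Pi Omega n r.
  by apply: eq_Pi (PiD Pg (PiZ (-1) Pp)) => x _; rewrite mulN1r.
have [sg sp sr] := And3 (sqPi Pg) (sqPi Pp)
  (sqPi Pr).
have rE e : e \in E -> << r, e >> = 0.
  move=> eE; have se := sqE e eE.
  have -> : << r, e >> = << g, e >> - << expansion Omega m w E g, e >> by exact: innerBl.
  rewrite expansion_adjoint//.
  have -> : << g, expansion Omega m w E e >> = << g, e >>.
    by apply: eq_inner => // x Ox; rewrite -EE.
  by rewrite subrr.
have expr0 x : expansion Omega m w E r x = 0.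
  rewrite /expansion big_seq; apply: big1 => e /rE ->; exact: mul0r.
(* A residual of norm zero vanishes on [Omega], so [g] is already reproduced and [E] is kept. *)
have [q0|q_neq0] := eqVneq << r, r >> 0.
  exists E; split => // h; rewrite inE => /predU1P[-> x Ox|/sE//].
  by apply/eqP; rewrite -subr_eq0; apply/eqP/(Pi_inner_eq0 Pr).
have q_gt0 : 0 < << r, r >> by rewrite lt_def q_neq0 inner_ge0.
pose c := (Num.sqrt << r, r >>)^-1.
have cc : c * c = << r, r >>^-1 by rewrite -invfM -expr2 sqr_sqrtr// ltW.
pose u x := c * r x.
have expE h x : expansion Omega m w (u :: E) h x =
    << h, u >> * u x + expansion Omega m w E h x.
  by rewrite /expansion big_cons.
(* Whatever [E] reproduces is orthogonal to r: move the expansion onto r, where it is zero. Hence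
   appending u leaves the old expansions unchanged. *)
have orth_r h : sqint h -> (forall x, Omega x -> h x = expansion Omega m w E h x) ->
    << h, r >> = 0.
  move=> sh hE; have -> : << h, r >> = << expansion Omega m w E h, r >> by exact: eq_inner.
  rewrite expansion_adjoint// -[RHS](inner0l m w Omega_measurable h) innerC.
  by apply: eq_inner.
have ext h : sqint h -> (forall x, Omega x -> h x = expansion Omega m w E h x) ->
    forall x, Omega x -> h x = expansion Omega m w (u :: E) h x.
  move=> sh hE x Ox; rewrite expE innerZr// orth_r// mulr0 mul0r add0r.
  exact: hE.
have Pu : Pi Omega n u by exact: PiZ.
exists (u :: E); split.
- by move=> e; rewrite inE => /predU1P[->|/PE].
- move=> e; rewrite inE => /predU1P[-> x Ox|eE]; last by apply: ext; [exact: sqE|exact: EE].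
  rewrite expE innerZl ?innerZr//; last exact: square_integrableZ.
  rewrite mulrA cc mulVf// mul1r /expansion big_seq big1 ?addr0// => e' e'E.
  by rewrite innerZl ?rE ?mulr0 ?mul0r//; exact: sqE.
- move=> h; rewrite inE => /predU1P[-> x Ox|hs]; last first.
    by apply: ext; [apply: sqPi (Ps h _); rewrite inE hs orbT|exact: sE].
  rewrite expE innerZr//.
  (* The difference g - r is the expansion of g, which is orthogonal to r. So <g, u> u = c^2 <r, r>
     r = r. *)
  have -> : << g, r >> = << r, r >>.
    apply/eqP; rewrite -subr_eq0.
    have -> : << g, r >> - << r, r >> = << (fun x => g x - r x), r >>.
      by apply/esym; exact: innerBl.
    have -> : << (fun x => g x - r x), r >> = << expansion Omega m w E g, r >>.
      by apply: eq_inner => // y _; rewrite /r; ring.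
    rewrite expansion_adjoint// innerC -(inner0l m w Omega_measurable g); apply/eqP.
    by apply: eq_inner.
  by rewrite /u mulrACA cc mulKf// subrK.
Qed.

End PolynomialProjections.

(** * Projections, components and reproducing kernels *)

Section Components.
Context {R : realType} {dim : nat}.
Local Notation T := (euclid R dim).
Variables (Omega : set T) (m : {measure set T -> \bar R}) (d : T -> T -> R).
Variable w : T -> R.
Hypothesis Omega_compact : compact (Omega : set 'rV[R]_dim).
Hypothesis d_metric : metric_on Omega d.
Hypothesis w_doubling : doubling_weight Omega m d w.
Hypothesis w_unit : wmeas m w Omega = 1.
Implicit Types (f g h : T -> R).

Local Notation sqint := (square_integrable Omega m w).
Local Notation "<< f , g >>" := (inner Omega m w f g).

Let w_weight : weight Omega m w. Proof. by case: w_doubling. Qed.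
Let Omega_measurable : measurable Omega.
Proof. exact: compact_euclid_measurable. Qed.
Let sqPi n f : Pi Omega n f -> sqint f.
Proof. exact: Pi_square_integrable. Qed.
Hint Resolve w_weight Omega_measurable : core.

(** The orthogonal projection onto Pi_n, through a chosen family. By [orthobasis_exists] the choice
    meets its specification. *)
Definition Pi_proj n : (T -> R) -> T -> R :=
  expansion Omega m w (xget [::] (orthobasis Omega m w n)).

(** The family built by [gram_schmidt] reproduces a spanning list, and linearity of the expansion
    carries this over to all of Pi_n. *)
Lemma orthobasis_exists n :
  orthobasis Omega m w n (xget [::] (orthobasis Omega m w n)).
Proof.
have [s Ps sP] := Pi_span Omega n.
have [E [PE EE sE]] := gram_schmidt Omega_compact d_metric w_doubling w_unit Ps.
apply: (@xgetPex _ [::]); exists E; split => // g Pg x Ox.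
have [c gc] := sP g Pg.
have sqE e : e \in E -> sqint e by move=> /PE /sqPi.
have sqs (i : 'I_(size s)) : sqint (nth (fun=> 0) s i).
  by apply: sqPi (Ps _ _); exact: mem_nth.
rewrite /expansion gc// [RHS]big_seq.
under [RHS]eq_bigr => e eE.
  have -> : << g, e >> = \sum_(i < size s) c i * << nth (fun=> 0) s i, e >>.
    rewrite (_ : << g, e >> =
      << (fun x => \sum_(i < size s) c i * nth (fun=> 0) s i x), e >>); last first.
      exact: eq_inner.
    have se := sqE e eE.
    rewrite inner_suml// => [|i _]; last exact: square_integrableZ (sqs i).
    by apply: eq_bigr => i _; rewrite innerZl.
  rewrite mulr_suml.
  over.
rewrite exchange_big/=; apply: eq_bigr => i _.
rewrite sE ?mem_nth// /expansion big_seq mulr_sumr.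
by apply: eq_bigr => e _; rewrite mulrA.
Qed.

Lemma Pi_proj_Pi n f : Pi Omega n (Pi_proj n f).
Proof. by apply: expansion_Pi => e; case: (orthobasis_exists n) => + _; exact. Qed.

Let sqproj n f : sqint (Pi_proj n f). Proof. exact: sqPi (Pi_proj_Pi n f). Qed.
Hint Resolve sqproj : core.

Lemma Pi_proj_id n g x : Pi Omega n g -> Omega x -> Pi_proj n g x = g x.
Proof. by case: (orthobasis_exists n) => _ EP Pg Ox; rewrite [RHS]EP. Qed.

(** Self-adjointness moves the projection onto g, which it fixes. *)
Lemma Pi_proj_inner n f g : sqint f -> Pi Omega n g ->
  << Pi_proj n f, g >> = << f, g >>.
Proof.
move=> sf Pg; have [PE _] := orthobasis_exists n.
rewrite expansion_adjoint//; last exact: sqPi Pg.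
  by apply: eq_inner => // x Ox; rewrite -/(Pi_proj n g x) Pi_proj_id.
by move=> e /PE /sqPi.
Qed.

Definition Vcomponent n f x :=
  Pi_proj n f x - (if n is k.+1 then Pi_proj k f x else 0).

Lemma Vspace_orthogonal n k f g : n <> k -> Vspace Omega m w n f ->
  Vspace Omega m w k g -> << f, g >> = 0.
Proof.
move=> nk [Pf Vf] [Pg Vg]; case: (ltngtP n k) => // lt; last exact: Vf lt g Pg.
by rewrite innerC; exact: Vg lt f Pf.
Qed.

Lemma Vcomponent_Vspace n f : sqint f -> Vspace Omega m w n (Vcomponent n f).
Proof.
move=> sf; split.
  rewrite /Vcomponent; case: n => [|n].
    by apply: eq_Pi (Pi_proj_Pi 0 f) => x _; rewrite subr0.
  apply: eq_Pi (PiD (Pi_proj_Pi n.+1 f) (PiZ (-1) _)); last first.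
    exact: Pi_leq (leqnSn n) (Pi_proj_Pi n f).
  by move=> x _; rewrite mulN1r.
case: n => // n k; rewrite ltnS => kn g Pg.
have Png := Pi_leq kn Pg.
rewrite innerBl//; last exact: sqPi Png.
by rewrite !Pi_proj_inner// ?subrr//; exact: Pi_leq (leqnSn n) Png.
Qed.

Lemma Vcomponent_Pi n f : sqint f -> Pi Omega n (Vcomponent n f).
Proof. by move=> sf; have [] := Vcomponent_Vspace n sf. Qed.

Let sqcomp n f : sqint f -> sqint (Vcomponent n f).
Proof. by move=> sf; exact: sqPi (Vcomponent_Pi n sf). Qed.
Hint Resolve sqcomp : core.

Lemma sum_Vcomponent n f x : \sum_(0 <= k < n.+1) Vcomponent k f x = Pi_proj n f x.
Proof.
elim: n => [|n IH]; first by rewrite big_nat1 /Vcomponent subr0.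
by rewrite big_nat_recr//= IH /Vcomponent addrC subrK.
Qed.

(** Projecting f to Pi_n keeps its pairing with v, and v is orthogonal to the part of f in
    Pi_(n-1). *)
Lemma inner_Vspace n f v : sqint f -> Vspace Omega m w n v ->
  << f, v >> = << Vcomponent n f, v >>.
Proof.
move=> sf Vv; have [Pv ov] := Vv; have sv := sqPi Pv.
rewrite -(Pi_proj_inner sf Pv) /Vcomponent; case: n Vv Pv ov => [|n] Vv Pv ov.
  by apply: eq_inner => // x _; rewrite subr0.
rewrite innerBl// [X in _ = _ - X]innerC (ov n)// ?subr0//.
exact: Pi_proj_Pi.
Qed.

Lemma inner_Vcomponent n f : sqint f ->
  << f, Vcomponent n f >> = << Vcomponent n f, Vcomponent n f >>.
Proof. by move=> sf; apply: inner_Vspace => //; exact: Vcomponent_Vspace. Qed.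

Lemma Pi_proj_kernel n f x : sqint f -> Pi_proj n f x =
  << f, (fun y => \sum_(e <- xget [::] (orthobasis Omega m w n)) e x * e y) >>.
Proof.
move=> sf; have [PE _] := orthobasis_exists n.
under [X in << _, X >>]eq_fun do rewrite big_seq.
rewrite inner_sumr// => [|e /PE /sqPi se]; last exact: square_integrableZ.
rewrite /Pi_proj /expansion big_seq; apply: eq_bigr => e /PE /sqPi se.
by rewrite innerZr// mulrC.
Qed.

(** [Pkernel] is picked by [xget], so some kernel has to be exhibited. The sum of e(x) e(y) over an
    orthobasis represents the projection onto Pi_n, and the difference of two consecutive ones
    represents [Vcomponent], which fixes V_n. *)
Lemma Pkernel_reproducing n :
  reproducing_kernel Omega m w n (Pkernel Omega m w n).
Proof.
pose Q k x y := \sum_(e <- xget [::] (orthobasis Omega m w k)) e x * e y.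
have PQ k x : Pi Omega k (Q k x).
  have [PE _] := orthobasis_exists k.
  rewrite /Q; under eq_fun do rewrite big_seq.
  by apply: Pi_sum => e /PE; exact: PiZ.
pose K x y := Q n x y - (if n is k.+1 then Q k x y else 0).
have sQ k x : sqint (Q k x) by exact: sqPi (PQ k x).
have innerK f x : sqint f -> << f, K x >> = Vcomponent n f x.
  move=> sf; rewrite /K /Vcomponent; case: (n) => [|k].
    rewrite subr0 Pi_proj_kernel//.
    by apply: eq_inner => // y _; rewrite subr0.
  by rewrite innerBr// !Pi_proj_kernel.
apply: (@xgetPex _ (fun _ _ => 0)); exists K; split.
  move=> x Ox; split.
    rewrite /K; case: (n) => [|k].
      by apply: eq_Pi (PQ 0%N x) => y _; rewrite subr0.
    apply: eq_Pi (PiD (PQ k.+1 x) (PiZ (-1) (Pi_leq (leqnSn k) (PQ k x)))).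
    by move=> y _; rewrite mulN1r.
  move=> k kn g Pg; rewrite innerC innerK; last exact: sqPi Pg.
  rewrite /Vcomponent; case: (n) kn => // l; rewrite ltnS => kl.
  have Plg := Pi_leq kl Pg.
  by rewrite !Pi_proj_id ?subrr//; exact: Pi_leq Plg.
move=> f [Pf of_] x Ox; rewrite innerK; last exact: sqPi Pf.
rewrite /Vcomponent Pi_proj_id//; case: (n) of_ => [|k] of_; first by rewrite subr0.
rewrite Pi_proj_kernel; last exact: sqPi Pf.
by rewrite (of_ k)// ?subr0//; exact: PQ.
Qed.

Lemma Pkernel_Vspace n x : Omega x -> Vspace Omega m w n (Pkernel Omega m w n x).
Proof. by move=> Ox; have [+ _] := Pkernel_reproducing n; exact. Qed.

(** Symmetry is not part of the specification. Reproducing P(x, .) at y and P(y, .) at x gives <P(x,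
    .), P(y, .)> in both cases. *)
Lemma Pkernel_sym n x y : Omega x -> Omega y ->
  Pkernel Omega m w n x y = Pkernel Omega m w n y x.
Proof.
have [KV Kr] := Pkernel_reproducing n => Ox Oy.
by rewrite (Kr _ (KV x Ox) y Oy) innerC -(Kr _ (KV y Oy) x Ox).
Qed.

(** Reproduction is specified on V_n only; it extends to any f because an element of V_n pairs only
    with the component of f there. *)
Lemma inner_Pkernel n f x : sqint f -> Omega x ->
  << f, Pkernel Omega m w n x >> = Vcomponent n f x.
Proof.
move=> sf Ox; have [KV Kr] := Pkernel_reproducing n.
rewrite (inner_Vspace sf (KV x Ox)).
by rewrite -Kr//; exact: Vcomponent_Vspace.
Qed.

Lemma inner_Vcomponent_Pkernel k n f x : sqint f -> Omega x ->
  << Vcomponent k f, Pkernel Omega m w n x >> = (k == n)%:R * Vcomponent k f x.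
Proof.
move=> sf Ox; have Vk := Vcomponent_Vspace k sf.
have [->|/eqP kn] := eqVneq k n.
  by rewrite mul1r; have [_ <-] := Pkernel_reproducing n => //; exact: Vcomponent_Vspace.
by rewrite mul0r; apply: Vspace_orthogonal Vk (Pkernel_Vspace n Ox).
Qed.

End Components.

(** * Density of polynomials *)

Section StepFunction.
Context {R : realType}.
Implicit Types (r s u y : R).

Lemma bernoulli_ler y k : 0 <= y <= 1 -> 1 - k%:R * y <= (1 - y) ^+ k.
Proof.
move=> /andP[y0 y1]; elim: k => [|k IH]; first by rewrite mul0r subr0.
rewrite exprS; have Y0 : 0 <= 1 - y by lra.
apply: le_trans (ler_wpM2l Y0 IH).
rewrite -natr1; have k0 : 0 <= k%:R :> R by [].
have := mulr_ge0 k0 (mulr_ge0 y0 y0); nra.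
Qed.

(** The induction step is (1 - y) (1 + (k + 1) y) <= 1 + k y. The lemma serves as the upper bound (1
    - y)^k <= 1 / (1 + k y). *)
Lemma bernoulli_inv y k : 0 <= y <= 1 -> (1 - y) ^+ k * (1 + k%:R * y) <= 1.
Proof.
move=> /andP[y0 y1]; elim: k => [|k IH]; first by rewrite mul0r addr0 mulr1.
have Y0 : 0 <= (1 - y) ^+ k by rewrite exprn_ge0//; lra.
apply: le_trans IH; rewrite exprSr -mulrA ler_wpM2l// -natr1.
have k0 : 0 <= k%:R :> R by [].
have := mulr_ge0 k0 (mulr_ge0 y0 y0); nra.
Qed.

(** Write r = s^2. By [bernoulli_inv] at 1 - s, n (1 - s) s^n <= 1, so the sequence is at most s^n /
    (1 - s). *)
Lemma cvg_nat_mul_expr r : 0 <= r < 1 -> n%:R * r ^+ n @[n --> \oo] --> 0.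
Proof.
move=> /andP[r0 r1]; pose s := Num.sqrt r.
have s0 : 0 <= s by exact: sqrtr_ge0.
have ss : s * s = r by rewrite -expr2 sqr_sqrtr.
have s1 : s < 1 by rewrite -sqrtr1 ltr_sqrt.
apply: (squeeze_cvgr (f := fun=> 0) (h := fun n => (1 - s)^-1 * s ^+ n)).
- apply: nearW => n; rewrite mulr_ge0 ?exprn_ge0//=.
  rewrite -ss exprMn mulrA ler_wpM2r ?exprn_ge0// -[leRHS]mul1r ler_pdivlMr ?subr_gt0//.
  have y01 : 0 <= 1 - s <= 1 by lra.
  have := bernoulli_inv n y01; rewrite subKr.
  have := exprn_ge0 n s0; nra.
- exact: cvg_cst.
- by apply: (@cvg_geometric R (1 - s)^-1 s); rewrite ger0_norm.
Qed.

(* The approximation of a step function in the Brosowski-Deutsch proof of the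
   Stone-Weierstrass theorem. *)
Lemma cvg_step u : 0 <= u <= 1 ->
  (1 - u ^+ n) ^+ (n * 2 ^ n) @[n --> \oo] --> ((u < 2^-1)%R%:R : R).
Proof.
move=> /andP[u0 u1].
have un n : 0 <= u ^+ n <= 1 by rewrite exprn_ge0// exprn_ile1.
have t0 n : 0 <= 1 - u ^+ n by rewrite subr_ge0; case/andP: (un n).
have t1 n : 1 - u ^+ n <= 1 by rewrite gerBl; case/andP: (un n).
(* The bounds are 1 - n (2u)^n from below if u < 1/2, and 1 / (1 + n (2u)^n) <= 1 / (n + 1) from
   above otherwise. The factor n in the exponent settles u = 1/2, where the exponent 2^n alone would
   lead to the limit 1/e. *)
have [ulo|uhi] := ltP u 2^-1.
- apply: (squeeze_cvgr (f := fun n => 1 - n%:R * (2 * u) ^+ n) (h := fun=> 1)).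
  + apply: nearW => n; rewrite exprn_ile1// andbT.
    rewrite exprMn mulrA -natrX -natrM.
    exact: bernoulli_ler.
  + rewrite -[X in _ --> X](subr0 1); apply: cvgB; first exact: cvg_cst.
    by apply: cvg_nat_mul_expr; apply/andP; split; lra.
  + exact: cvg_cst.
- apply: (squeeze_cvgr (f := fun=> 0) (h := @harmonic R)).
  + apply: nearW => n; rewrite exprn_ge0//=.
    have := bernoulli_inv (n * 2 ^ n) (un n).
    have := exprn_ge0 (n * 2 ^ n) (t0 n).
    set t := _ ^+ (n * 2 ^ n) => tge0 H.
    rewrite /harmonic -[leRHS]mul1r ler_pdivlMr//.
    apply: le_trans H; rewrite ler_wpM2l// -natr1 addrC lerD2l.
    rewrite natrM natrX -mulrA ler_peMr// -exprMn exprn_ege1//; lra.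
  + exact: cvg_cst.
  + exact: cvg_harmonic.
Qed.

End StepFunction.

Section Density.
Context {R : realType} {dim : nat}.
Local Notation T := (euclid R dim).
Local Notation V := 'rV[R]_dim.
Variables (Omega : set T) (m : {measure set T -> \bar R}) (w : T -> R).
Hypothesis Omega_compact : compact (Omega : set V).
Hypothesis w_weight : weight Omega m w.
Implicit Types (A B : set T) (f g h p : T -> R).

Local Notation sqint := (square_integrable Omega m w).
Local Notation "<< f , g >>" := (inner Omega m w f g).

Let Omega_measurable : measurable Omega.
Proof. exact: compact_euclid_measurable. Qed.
Hint Resolve w_weight Omega_measurable : core.

(** The bounds 0 and 1 survive complements and products, and they supply the constant 1 as a
    dominating function. *)
Definition poly_limit A := exists p : nat -> T -> R,
  [/\ forall N, exists n, Pi Omega n (p N),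
      forall N x, Omega x -> 0 <= p N x <= 1 &
      forall x, Omega x -> p N x @[N --> \oo] --> (\1_A x : R)].

Lemma poly_limitC A : poly_limit A -> poly_limit (~` A).
Proof.
move=> [p [Pp p01 pA]]; exists (fun N x => 1 - p N x); split.
- move=> N; have [n PN] := Pp N; exists n.
  by apply: eq_Pi (PiD (Pi_cst _ _ 1) (PiZ (-1) PN)) => x _; rewrite mulN1r.
- by move=> N x Ox; have := p01 N x Ox; lra.
- move=> x Ox; rewrite (_ : \1_(~` A) x = 1 - \1_A x :> R); last first.
    by rewrite !indicE in_setC; case: (x \in A); rewrite ?subrr ?subr0.
  apply: cvgB; [exact: cvg_cst|exact: pA].
Qed.

Lemma poly_limitT : poly_limit setT.
Proof.
exists (fun _ _ => 1); split.
- by move=> _; exists 0%N; exact: Pi_cst.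
- by move=> *; rewrite ler01 lexx.
- by move=> x _; rewrite indicT; exact: cvg_cst.
Qed.

Lemma poly_limitI A B : poly_limit A -> poly_limit B -> poly_limit (A `&` B).
Proof.
move=> [p [Pp p01 pA]] [q [Pq q01 qB]]; exists (fun N x => p N x * q N x); split.
- move=> N; have [n PN] := Pp N; have [k QN] := Pq N.
  by exists (n + k)%N; exact: PiM.
- move=> N x Ox; have /andP[p0 p1] := p01 N x Ox; have /andP[q0 q1] := q01 N x Ox.
  by rewrite mulr_ge0// mulr_ile1.
- by move=> x Ox; rewrite indicI/=; apply: cvgM; [exact: pA|exact: qB].
Qed.

Lemma poly_limit_bigcap (I : Type) (s : seq I) (F : I -> set T) :
  (forall i, poly_limit (F i)) -> poly_limit (\big[setI/setT]_(i <- s) F i).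
Proof.
move=> PF; elim: s => [|i s IH]; first by rewrite big_nil; exact: poly_limitT.
by rewrite big_cons; exact: poly_limitI.
Qed.

Lemma poly_limit_bigcup (I : eqType) (s : seq I) (F : I -> set T) :
  (forall i, i \in s -> poly_limit (F i)) -> poly_limit (\big[setU/set0]_(i <- s) F i).
Proof.
elim: s => [|i s IH] PF.
  by rewrite big_nil -setCT; exact/poly_limitC/poly_limitT.
rewrite big_cons -[X in poly_limit X]setCK setCU; apply/poly_limitC/poly_limitI.
  by apply/poly_limitC/PF; rewrite inE eqxx.
by apply/poly_limitC/IH => j js; apply: PF; rewrite inE js orbT.
Qed.

(** An affine rescaling u of q has values in [0, 1] on [Omega] and is below 1/2 exactly where q < c,
    so [cvg_step] applies to u. *)
Lemma poly_limit_sublevel n q c : Pi Omega n q -> poly_limit [set x | q x < c].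
Proof.
move=> Pq; have [M M0 qM] := Pi_bounded Omega_compact Pq.
(* As |q - c| <= M + |c| on [Omega], this factor gives |e (q - c)| <= 1/2. *)
pose e := (2 * (M + `|c|))^-1.
have e0 : 0 < e by rewrite invr_gt0 mulr_gt0// ltr_pwDl.
pose u x := 2^-1 + e * (q x - c).
have Pu : Pi Omega n u.
  apply: eq_Pi (PiD (Pi_cst _ _ (2^-1 - e * c)) (PiZ e Pq)) => x _.
  by rewrite /u; ring.
have u01 x : Omega x -> 0 <= u x <= 1.
  move=> Ox; have : `|e * (q x - c)| <= 2^-1.
    rewrite normrM gtr0_norm// /e invfM -mulrA ler_piMr// mulrC ler_pdivrMr ?mul1r; last first.
      by rewrite ltr_pwDl.
    by rewrite (le_trans (ler_normB _ _))// lerD2r qM.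
  rewrite ler_norml /u; lra.
exists (fun N x => (1 - u x ^+ N) ^+ (N * 2 ^ N)); split.
- move=> N; eexists; apply: PiX.
  apply: eq_Pi (PiD (Pi_cst _ _ 1) (PiZ (-1) (PiX N Pu))) => x _.
  by rewrite mulN1r.
- move=> N x Ox; have /andP[u0 u1] := u01 x Ox.
  by rewrite exprn_ge0 ?exprn_ile1// ?subr_ge0 ?gerBl ?exprn_ile1 ?exprn_ge0.
- move=> x Ox; rewrite indicE (_ : (x \in _) = (u x < 2^-1)); first exact/cvg_step/u01.
  rewrite /u gtrDl pmulr_rlt0// subr_lt0.
  by apply/idP/idP => [/set_mem//|qc]; exact/mem_set.
Qed.

(* Balls of the sup norm are boxes, hence finite intersections of sublevel sets
   of polynomials. *)
Lemma poly_limit_ball (x : V) (e : R) : 0 < e -> poly_limit (ball x e).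
Proof.
move=> e0; rewrite (_ : ball x e = \big[setI/setT]_(i < dim)
   [set y : T | (coordinate (x : T) i - coordinate y i) ^+ 2 < e ^+ 2]).
  apply: poly_limit_bigcap => i.
  apply: (@poly_limit_sublevel (1 * 2)); apply: PiX.
  apply: eq_Pi (PiD (Pi_cst _ _ (coordinate (x : T) i)) (PiZ (-1) (Pi_coordinate _ i))) => y _.
  by rewrite mulN1r.
have E (r : R) : (r ^+ 2 < e ^+ 2) = (`|r| < e).
  by rewrite -(real_normK (num_real r)) ltr_pXn2r// nnegrE// ltW.
rewrite -bigcap_seq.
apply/seteqP; split => y /=.
  by move=> [_ H] i _; rewrite /= E; exact: H.
by move=> H; split => // i j; rewrite (ord1 i); have := H j (mem_index_enum j); rewrite /= E.
Qed.

End Density.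

(** * Approximation in the weighted L^2 norm *)

Section DensityL2.
Context {R : realType} {dim : nat}.
Local Notation T := (euclid R dim).
Local Notation V := 'rV[R]_dim.
Variables (Omega : set T) (m : {measure set T -> \bar R}) (w : T -> R).
Hypothesis Omega_compact : compact (Omega : set V).
Hypothesis w_weight : weight Omega m w.
Implicit Types (A B : set T) (f g h p : T -> R).

Local Notation sqint := (square_integrable Omega m w).
Local Notation "<< f , g >>" := (inner Omega m w f g).
Local Notation sqdist f g := << (fun x => f x - g x), (fun x => f x - g x) >>.

Let Omega_measurable : measurable Omega.
Proof. exact: compact_euclid_measurable. Qed.
Hint Resolve w_weight Omega_measurable : core.

Definition approximable f := sqint f /\
  forall e : R, 0 < e -> exists n, exists2 p, Pi Omega n p & sqdist f p <= e.

Let sqPi n p : Pi Omega n p -> sqint p. Proof. exact: Pi_square_integrable. Qed.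

Lemma approximable_limit f : sqint f ->
  (forall e : R, 0 < e -> exists2 g, approximable g & sqdist f g <= e) ->
  approximable f.
Proof.
move=> sf fg; split => // e e0; have e4 : 0 < e / 4 by rewrite divr_gt0.
have [g [sg gp] fge] := fg _ e4; have [n [p Pp gpe]] := gp _ e4.
exists n, p => //; have sp := sqPi Pp.
rewrite (_ : sqdist f p = << (fun x => (f x - g x) + (g x - p x)),
    (fun x => (f x - g x) + (g x - p x)) >>); last first.
  by apply: eq_inner => x _; rewrite subrKA.
apply: le_trans (inner_sqD_le _ _ _ _) _ => //; try exact: square_integrableB.
lra.
Qed.

Lemma Pi_approximable n p : Pi Omega n p -> approximable p.
Proof.
move=> Pp; split => [|e e0]; first exact: sqPi Pp.
exists n, p => //; rewrite (_ : sqdist p p = 0) ?ltW//.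
rewrite -[RHS](inner0l m w Omega_measurable (fun=> 0)).
by apply: eq_inner => x _; rewrite subrr.
Qed.

Lemma approximableD f g :
  approximable f -> approximable g -> approximable (fun x => f x + g x).
Proof.
move=> [sf fp] [sg gq]; split => [|e e0]; first exact: square_integrableD.
have e4 : 0 < e / 4 by rewrite divr_gt0.
have [n [p Pp fpe]] := fp _ e4; have [k [q Pq gqe]] := gq _ e4.
exists (maxn n k), (fun x => p x + q x).
  by apply: PiD; [apply: Pi_leq Pp; exact: leq_maxl|apply: Pi_leq Pq; exact: leq_maxr].
have sp := sqPi Pp; have sq := sqPi Pq.
rewrite (_ : << _, _ >> = << (fun x => (f x - p x) + (g x - q x)),
    (fun x => (f x - p x) + (g x - q x)) >>); last first.
  by apply: eq_inner => x _; ring.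
apply: le_trans (inner_sqD_le _ _ _ _) _ => //; try exact: square_integrableB.
lra.
Qed.

Lemma approximableZ c f : approximable f -> approximable (fun x => c * f x).
Proof.
move=> [sf fp]; split => [|e e0]; first exact: square_integrableZ.
have c0 : 0 < c ^+ 2 + 1 by rewrite ltr_wpDl// sqr_ge0.
have [n [p Pp fpe]] := fp (e / (c ^+ 2 + 1)) (divr_gt0 e0 c0).
exists n, (fun x => c * p x); first exact: PiZ.
have sfp := square_integrableB Omega_measurable w_weight sf (sqPi Pp).
rewrite (_ : << _, _ >> = << (fun x => c * (f x - p x)), (fun x => c * (f x - p x)) >>);
  last by apply: eq_inner => x _; ring.
rewrite innerZl ?innerZr//; last exact: square_integrableZ.
rewrite ler_pdivlMr// in fpe; apply: le_trans fpe.
have := inner_ge0 w_weight (fun x => f x - p x); nra.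
Qed.

Lemma approximable_sum (I : Type) (s : seq I) (F : I -> T -> R) :
  (forall i, approximable (F i)) -> approximable (fun x => \sum_(i <- s) F i x).
Proof.
move=> AF; elim: s => [|i s IH].
  rewrite (_ : (fun _ => _) = fun=> 0); first exact: Pi_approximable (Pi_cst _ 0 0).
  by apply/funext => x; rewrite big_nil.
by under eq_fun do rewrite big_cons; exact: approximableD.
Qed.

(** Dominated convergence with the integrable bound h^2 w. *)
Lemma dominated_sqdist (F : nat -> T -> R) f h :
  (forall n, measurable_fun Omega (F n)) -> measurable_fun Omega f -> sqint h ->
  (forall n x, Omega x -> `|f x - F n x| <= h x) ->
  (forall x, Omega x -> F n x @[n --> \oo] --> f x) ->
  sqdist f (F n) @[n --> \oo] --> 0.
Proof.
move=> mF mf sh Fh Ff; have mw := weight_measurable w_weight.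
have w0 x : Omega x -> 0 <= w x by exact: weight_ge0.
apply: fine_cvg; rewrite -[X in _ --> X](integral0 m Omega).
apply: (dominated_cvg Omega_measurable
  (g := fun x => (h x ^+ 2 * w x)%:E)) => //.
- move=> n; apply/measurable_EFinP.
  by apply: measurable_funM => //; apply: measurable_funM; exact: measurable_funB.
- move=> x Ox; apply: cvg_EFin; first exact: nearW.
  rewrite (_ : 0 = (f x - f x) * (f x - f x) * w x); last by rewrite subrr !mul0r.
  have fF : f x - F n x @[n --> \oo] --> f x - f x.
    by apply: cvgB; [exact: cvg_cst|exact: Ff].
  by apply: cvgM; [exact: cvgM|exact: cvg_cst].
- by case: sh.
- move=> n x Ox; have Fhx := Fh n x Ox.
  rewrite abse_EFin lee_fin normrM (ger0_norm (w0 x Ox)) ler_wpM2r ?w0//.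
  by rewrite -expr2 normrX lerXn2r// nnegrE// (le_trans _ Fhx).
Qed.

Lemma approximable_cvg (F : nat -> T -> R) f h :
  (forall n, approximable (F n)) -> sqint f -> sqint h ->
  (forall n x, Omega x -> `|f x - F n x| <= h x) ->
  (forall x, Omega x -> F n x @[n --> \oo] --> f x) -> approximable f.
Proof.
move=> AF sf sh Fh Ff; apply: approximable_limit => // e e0.
have mF n : measurable_fun Omega (F n) by case: (AF n) => -[].
have /cvgrPdist_le/(_ e e0)[N _ HN] := dominated_sqdist mF (proj1 sf) sh Fh Ff.
exists (F N) => //; have := HN N (leqnn N); rewrite /= sub0r normrN.
exact: le_trans (ler_norm _).
Qed.

Lemma square_integrable_indic A : measurable A -> sqint (\1_A : T -> R).
Proof.
move=> mA; apply: (bounded_square_integrable Omega_measurable w_weight (M := 1)).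
  exact: measurable_indic.
by move=> x _; rewrite indicE ger0_norm//; case: (_ \in _).
Qed.

Lemma square_integrable1 : sqint (fun=> 1).
Proof. exact: sqPi (Pi_cst _ 0 1). Qed.

Lemma indic_dist_le1 A (r : R) x : 0 <= r <= 1 -> `|\1_A x - r| <= 1.
Proof. by rewrite indicE ler_norml; case: (_ \in _) => /=; lra. Qed.

Lemma approximable_poly_limit A :
  measurable A -> poly_limit Omega A -> approximable (\1_A : T -> R).
Proof.
move=> mA [p [Pp p01 pA]].
apply: (approximable_cvg (F := p) (h := fun=> 1)) => //.
- by move=> N; have [n PN] := Pp N; exact: Pi_approximable PN.
- exact: square_integrable_indic.
- exact: square_integrable1.
- by move=> N x Ox; exact/indic_dist_le1/p01.
Qed.

(** Compactness gives a finite cover of [Omega] by balls of radius [e n]; the union of those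
    contained in U approximates U. These unions need not increase, but each point of U in [Omega]
    belongs to all of them from some n on. *)
Lemma approximable_open (U : set V) : open U -> approximable (\1_U : T -> R).
Proof.
move=> oU; have mU := open_euclid_measurable oU.
(* Half of 1 / (n + 1), so that a covering ball that contains x lies in the ball of radius 1 / (n +
   1) around x. *)
pose e n : R := n.+1%:R^-1 / 2.
have e0 n : 0 < e n by rewrite divr_gt0.
have cover n : exists s : seq V, Omega `<=` \bigcup_(y in [set` s]) ball y (e n).
  move: Omega_compact; rewrite compact_cover.
  move=> /(_ V Omega (fun y => ball y (e n))) [].
  - by move=> i _; exact: ball_open.
  - by move=> x Ox; exists x => //; exact: ballxx.
  - by move=> D _ Dcov; exists (finmap.enum_fset D).
pose s n := projT1 (cid (cover n)).
have sP n : Omega `<=` \bigcup_(y in [set` s n]) ball y (e n).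
  by rewrite /s; case: (cid _).
pose W n : set T :=
  \big[setU/set0]_(y <- [seq y <- s n | `[< ball y (e n) `<=` U >]]) ball y (e n).
have WU n : W n `<=` U.
  move=> x; rewrite /W -bigcup_seq => -[y /=]; rewrite mem_filter => /andP[/asboolP yU _].
  exact: yU.
have mW n : measurable (W n).
  apply: bigsetU_measurable => y _; apply: open_euclid_measurable.
  exact: ball_open.
have xW x : Omega x -> U x -> \forall n \near \oo, W n x.
  move=> Ox Ux; have /nbhs_ballP[r /= r0 rU] : nbhs (x : V) U by exact: open_nbhs_nbhs.
  near=> n; have [y ys yx] := sP n x Ox.
  rewrite /W -bigcup_seq; exists y => //=; rewrite mem_filter; apply/andP; split => //.
  apply/asboolP => z yz; apply: rU.
  apply: (@le_ball _ _ _ (n.+1%:R^-1)); last first.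
    by rewrite [X in ball _ X](splitr _); apply: ball_triangle yz; exact: ball_sym.
  by rewrite ltW//; near: n; exact: near_infty_natSinv_lt (PosNum r0).
apply: (approximable_cvg (F := fun n => \1_(W n)) (h := fun=> 1)).
- move=> n; apply: approximable_poly_limit => //.
  by apply: poly_limit_bigcup => y _; exact: poly_limit_ball.
- exact: square_integrable_indic.
- exact: square_integrable1.
- move=> n x _; apply: indic_dist_le1; rewrite [\1__ x]indicE.
  by case: (_ \in _); rewrite /= ?lexx ?ler01.
- move=> x Ox; apply: cvg_near_cst.
  have [Ux|nUx] := pselect (U x).
    have := xW x Ox Ux; apply: filterS => n Wx.
    by rewrite !indicE !mem_set.
  apply: nearW => n; rewrite !indicE !memNset//.
  by move=> /WU.
Unshelve. all: by end_near. Qed.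

End DensityL2.

Section DensityTheorem.
Context {R : realType} {dim : nat}.
Local Notation T := (euclid R dim).
Local Notation V := 'rV[R]_dim.
Variables (Omega : set T) (m : {measure set T -> \bar R}) (w : T -> R).
Hypothesis Omega_compact : compact (Omega : set V).
Hypothesis w_weight : weight Omega m w.
Implicit Types (A B : set T) (f g h p : T -> R).

Local Notation sqint := (square_integrable Omega m w).
Local Notation approximable := (approximable Omega m w).

Let Omega_measurable : measurable Omega.
Proof. exact: compact_euclid_measurable. Qed.
Hint Resolve w_weight Omega_measurable : core.

(** Open sets form a generating pi-system, and approximability passes to complements and countable
    disjoint unions, so Dynkin induction applies. *)
Lemma approximable_indic A : measurable A -> approximable (\1_A : T -> R).
Proof.
move=> mA; apply: (@dynkin_induction _ T (@open V)
  (fun A => approximable (\1_A : T -> R)) _ _ _ _ _ _ A mA) => //.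
- by move=> *; exact: openI.
- by rewrite indicT; exact: (Pi_approximable Omega_compact w_weight (Pi_cst _ 0 1)).
- by move=> U oU; exact: (approximable_open Omega_compact w_weight).
- move=> S mS AS.
  rewrite (_ : \1_(~` S) = fun x => 1 + -1 * \1_S x :> R); last first.
    apply/funext => x; rewrite !indicE in_setC.
    by case: (x \in S); rewrite /= ?mulr1 ?mulr0 ?subrr ?addr0.
  apply: approximableD => //; last exact: approximableZ.
  exact: (Pi_approximable Omega_compact w_weight (Pi_cst _ 0 1)).
- move=> F mF tF AF.
  have sumE n x : \sum_(0 <= k < n) \1_(F k) x = \1_(\bigcup_(k < n) F k) x :> R.
    elim: n => [|n IH]; first by rewrite big_geq// bigcup_mkord big_ord0 indic0.
    rewrite big_nat_recr//= IH [in RHS]bigcup_mkord big_ord_recr/= -bigcup_mkord.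
    rewrite !indicE in_setU; have [xFn|_] := boolP (x \in F n); last by rewrite orbF addr0.
    rewrite orbT memNset ?add0r// => -[k /= kn Fkx].
    have kn_eq : k = n by apply: tF => //; exists x; split => //; exact: set_mem.
    by rewrite kn_eq ltnn in kn.
  apply: (approximable_cvg Omega_compact w_weight
    (F := fun n x => \sum_(0 <= k < n) \1_(F k) x) (h := fun=> 1)).
  + by move=> n; exact: (approximable_sum Omega_compact w_weight).
  + apply: (square_integrable_indic Omega_compact w_weight); exact: bigcup_measurable.
  + exact: square_integrable1.
  + move=> n x _; rewrite sumE; apply: indic_dist_le1.
    by rewrite indicE; case: (_ \in _); rewrite /= ?lexx ?ler01.
  + move=> x _; under eq_fun do rewrite sumE; apply: cvg_near_cst.
    have [[k _ Fkx]|nF] := pselect ((\bigcup_k F k) x).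
      exists k.+1 => // n /= kn; rewrite !indicE !mem_set//; exists k => //.
    by apply: nearW => n; rewrite !indicE !memNset// => -[k kn Fk]; apply: nF; exists k.
Qed.

(** The simple approximations stay between 0 and f on [Omega], so f itself dominates the errors. *)
Lemma approximable_ge0 f : sqint f -> (forall x, Omega x -> 0 <= f x) ->
  approximable f.
Proof.
move=> sf f0; have mf : measurable_fun Omega (EFin \o f).
  by apply/measurable_EFinP; case: sf.
pose F := nnsfun_approx Omega_measurable mf.
have F0 x : Omega x -> (0 <= (EFin \o f) x)%E by move=> Ox; rewrite lee_fin f0.
apply: (approximable_cvg Omega_compact w_weight (F := fun n => F n : T -> R) (h := f)) => //.
- move=> n; have -> : (F n : T -> R) = _ := funext (fimfunEord (F n)).
  apply: (approximable_sum Omega_compact w_weight) => i.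
  by apply: approximableZ => //; exact: approximable_indic.
- move=> n x Ox; have := le_approx n F0 Ox.
  rewrite /F nnsfun_approxE lee_fin => le1.
  rewrite ger0_norm ?subr_ge0// gerBl.
  by rewrite -(nnsfun_approxE Omega_measurable mf).
- by move=> x Ox; have /= /fine_cvg := cvg_nnsfun_approx Omega_measurable mf F0 Ox.
Qed.

Theorem polynomials_dense f (e : R) : sqint f -> 0 < e ->
  exists n, exists2 p, Pi Omega n p &
    inner Omega m w (fun x => f x - p x) (fun x => f x - p x) <= e.
Proof.
move=> sf e0; suff [_] : approximable f by exact.
rewrite (_ : f = fun x => Num.max (f x) 0 + -1 * Num.max (- f x) 0); last first.
  apply/funext => x; rewrite mulN1r.
  have [fx|fx] := leP 0 (f x).
    by rewrite [X in _ - X]max_r ?subr0// oppr_le0.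
  by rewrite max_l ?add0r ?opprK// oppr_ge0 ltW.
have sqmax g : sqint g -> sqint (fun x => Num.max (g x) 0).
  move=> sg; have mg : measurable_fun Omega (fun x => Num.max (g x) 0).
    by apply: measurable_maxr => //; case: sg.
  split => //; apply: integrable_le_real (proj2 sg) _ => //.
    apply: measurable_funM; first exact: measurable_funX.
    exact: weight_measurable.
  move=> x Ox; have w0 := weight_ge0 w_weight Ox.
  rewrite normrM (ger0_norm w0) ler_wpM2r// ger0_norm ?sqr_ge0//.
  by have [_|_] := leP (g x) 0; rewrite ?lexx ?expr0n ?sqr_ge0.
apply: approximableD => //; last apply: approximableZ => //.
  apply: approximable_ge0; first exact: sqmax.
  by move=> x _; rewrite le_max lexx orbT.
apply: approximable_ge0 => [|x _]; last by rewrite le_max lexx orbT.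
apply: sqmax; rewrite (_ : (fun x => - f x) = fun x => -1 * f x).
  exact: square_integrableZ.
by apply/funext => x; rewrite mulN1r.
Qed.

End DensityTheorem.

(** * The frame *)

Section Cutoff.
Context {R : realType}.
Variable a : R -> R.
Hypothesis a_cutoff : cutoff_b a.
Hypothesis a_square : forall t, 1 / 2 <= t <= 1 -> a t ^+ 2 + a (2 * t) ^+ 2 = 1.

Lemma cutoff_support t : a t != 0 -> 2^-1 <= t <= 2.
Proof.
move=> at0; have [_ _ supp] := a_cutoff.
have := supp t (@subset_closure _ [set t | a t != 0] t at0).
by rewrite /= in_itv.
Qed.

Lemma cutoff_lt_half t : t < 2^-1 -> a t = 0.
Proof.
move=> t2; apply/eqP; apply: contraT => /cutoff_support /andP[].
by rewrite leNgt t2.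
Qed.

(** The support condition only rules out t > 2. At t = 2 continuity decides: a nonzero value there
    would persist slightly beyond 2. *)
Lemma cutoff_ge2 t : 2 <= t -> a t = 0.
Proof.
rewrite le_eqVlt => /predU1P[<-|t2]; apply/eqP; apply: contraT => at0; last first.
  by have /andP[_] := cutoff_support at0; rewrite leNgt t2.
have [sm _ _] := a_cutoff.
have ca : {for 2, continuous a}.
  by apply: differentiable_continuous; apply/derivable1_diffP; exact: (sm 0%N).
have : \forall t \near (2 : R), a t != 0.
  have := cvgr_neq0 _ ca at0; exact.
move=> /nbhs_ballP[e /= e0 he].
have : a (2 + e / 2) != 0.
  by apply: he; rewrite /ball/= opprD addNKr normrN gtr0_norm; lra.
move=> /cutoff_support; lra.
Qed.

(* The coefficient of P_k in F_j. *)
Definition level_coef j k : R :=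
  if j is i.+1 then a (k%:R / (2 ^ i)%N%:R) else (k == 0)%N%:R.

Lemma level_coef_eq0 j k : (2 ^ j < k)%N -> level_coef j k = 0.
Proof.
case: j => [|i] /= ik; first by case: k ik.
apply: cutoff_ge2; rewrite ler_pdivlMr ?ltr0n ?expn_gt0// -natrM ler_nat.
by rewrite -expnS ltnW.
Qed.

(** The coefficient of v_k in the frame expansion summed over the levels 0 to n + 1. The last of
    these has scale 2^n, hence the shift by two. *)
Definition level_weight n k := \sum_(0 <= j < n.+2) level_coef j k ^+ 2.

Lemma level_weight0 n : level_weight n 0 = 1.
Proof.
rewrite /level_weight big_nat_recl//= expr1n big1 ?addr0// => i _.
by rewrite mul0r cutoff_lt_half ?expr0n.
Qed.

(** Induction on n: passing to n + 1 halves t. When the new t lies in [1/2, 1), the new term a(t)^2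
    completes the old value a(2t)^2 to 1; below 1/2 it adds nothing, and from 1 on the old value was
    0. *)
Lemma level_weightS n k : level_weight n k.+1 =
  let t := k.+1%:R / (2 ^ n)%N%:R in
  if 2 <= t then 0 else if 1 <= t then a t ^+ 2 else 1.
Proof.
rewrite /level_weight big_nat_recl//= expr0n/= add0r.
elim: n => [|n IH].
  rewrite big_nat1 expn0 divr1; case: (leP 2 _) => [/cutoff_ge2 ->|_].
    by rewrite expr0n.
  by rewrite ler1n.
rewrite big_nat_recr//= {}IH.
have -> : k.+1%:R / (2 ^ n)%N%:R = 2 * (k.+1%:R / (2 ^ n.+1)%N%:R) :> R.
  by rewrite expnS natrM invfM mulrCA mulVKf.
set t := k.+1%:R / _.
have [t2|t2] := leP 2 t.
  rewrite (cutoff_ge2 t2) expr0n addr0; case: ifP => // /negbT; lra.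
have [t1|t1] := leP 1 t.
  rewrite ifT ?add0r//; lra.
have [h|h] := leP 2^-1 t.
  rewrite ifF; last by apply/negbTE; lra.
  rewrite ifT; last by lra.
  by rewrite addrC a_square//; lra.
rewrite (cutoff_lt_half h) expr0n addr0 ifF; last by apply/negbTE; lra.
by rewrite ifF//; apply/negbTE; lra.
Qed.

Lemma level_weight_ge0 n k : 0 <= level_weight n k.
Proof. by apply: sumr_ge0 => j _; exact: sqr_ge0. Qed.

Lemma level_weight_le1 n k : level_weight n k <= 1.
Proof.
case: k => [|k]; first by rewrite level_weight0.
rewrite level_weightS /=; set t := _ / _.
have [//|t2] := leP 2 t; have [t1|//] := leP 1 t.
(* For 1 <= t < 2 the identity [a_square] at t / 2 bounds a(t)^2 by 1. *)
have t01 : 1 / 2 <= t / 2 <= 1 by lra.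
have := a_square t01; rewrite mulrCA mulfV// mulr1 => <-.
by rewrite lerDr sqr_ge0.
Qed.

Lemma level_weight_eq1 n k : (k < 2 ^ n)%N -> level_weight n k = 1.
Proof.
case: k => [_|k kn]; first exact: level_weight0.
have t1 : k.+1%:R / (2 ^ n)%N%:R < 1 :> R.
  by rewrite ltr_pdivrMr ?ltr0n ?expn_gt0// mul1r ltr_nat.
by rewrite level_weightS/= !ifF//; apply/negbTE; lra.
Qed.

End Cutoff.

(** * Each frame level as a combination of components *)

Section Frame.
Context {R : realType} {dim : nat}.
Local Notation T := (euclid R dim).
Variables (Omega : set T) (m : {measure set T -> \bar R}) (d : T -> T -> R).
Variable w : T -> R.
Hypothesis Omega_compact : compact (Omega : set 'rV[R]_dim).
Hypothesis d_metric : metric_on Omega d.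
Hypothesis w_doubling : doubling_weight Omega m d w.
Hypothesis w_unit : wmeas m w Omega = 1.
Variable a : R -> R.
Hypothesis a_cutoff : cutoff_b a.
Hypothesis a_square : forall t, 1 / 2 <= t <= 1 -> a t ^+ 2 + a (2 * t) ^+ 2 = 1.
Variables (Xi : nat -> set T) (lambda : nat -> T -> R).
Hypothesis Xi_Omega : forall j, Xi j `<=` Omega.
Hypothesis lambda_gt0 : forall j z, Xi j z -> 0 < lambda j z.
Hypothesis lambda_cubature : forall j f, Pi Omega (2 ^ j.+1) f ->
  \int[m]_(x in Omega) (f x * w x) = \sum_(z \in Xi j) lambda j z * f z.
Variable f : T -> R.
Hypothesis f_sqint : square_integrable Omega m w f.

Local Notation sqint := (square_integrable Omega m w).
Local Notation "<< f , g >>" := (inner Omega m w f g).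
Local Notation P := (Pkernel Omega m w).
Local Notation v := (fun k => Vcomponent Omega m w k f).
Local Notation c := (level_coef a).
Local Notation psi := (frame Omega m a w lambda).

Let w_weight : weight Omega m w. Proof. by case: w_doubling. Qed.
Let Omega_measurable : measurable Omega.
Proof. exact: compact_euclid_measurable. Qed.
Let sqPi n g : Pi Omega n g -> sqint g.
Proof. exact: Pi_square_integrable. Qed.
Let vPi k : Pi Omega k (v k).
Proof. exact: (Vcomponent_Pi Omega_compact d_metric w_doubling). Qed.
Let sqv k : sqint (v k). Proof. exact: sqPi (vPi k). Qed.
Let PV k x : Omega x -> Vspace Omega m w k (P k x).
Proof. exact: (Pkernel_Vspace Omega_compact d_metric w_doubling). Qed.
Let sqP k x : Omega x -> sqint (P k x).
Proof. by move=> /(PV k)[+ _]; exact: sqPi. Qed.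
Let P_sym k x y : Omega x -> Omega y -> P k x y = P k y x.
Proof. exact: (Pkernel_sym Omega_compact d_metric w_doubling). Qed.
Hint Resolve w_weight Omega_measurable sqv : core.

(** The kernel of degree 0 is constant in its second variable, and reproducing the function 1
    against total mass 1 forces the constant to be 1. Level 0 thus obeys the same formula as the
    others. *)
Lemma Pkernel0 x y : Omega x -> Omega y -> P 0 x y = 1.
Proof.
move=> Ox Oy.
have [[p sp Pp] _] := PV 0 Ox.
have V1 : Vspace Omega m w 0 (fun=> 1) by split; first exact: Pi_cst.
have [_ /(_ _ V1 x Ox)] := Pkernel_reproducing Omega_compact d_metric w_doubling w_unit 0.
rewrite (msize1_polyC sp) in Pp.
have Pc z : Omega z -> P 0 x z = P 0 x y * 1.
  by move=> Oz; rewrite mulr1 !Pp// /poly_eval !mevalC.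
have -> : << (fun=> 1), P 0 x >> = << (fun=> 1), (fun=> P 0 x y * 1) >>.
  by apply: eq_inner => // z Oz; exact: Pc.
have s1 : sqint (fun=> 1) by exact: sqPi (Pi_cst _ 0 1).
rewrite innerZr// => /esym; have -> : << (fun=> 1), (fun=> 1) >> = 1.
  by rewrite -[RHS]w_unit; apply: eq_Rintegral => z _; rewrite !mul1r.
by rewrite mulr1.
Qed.

(** The defining partial sums are constant from 2n + 1 terms on. Leaving the cut N free lets several
    levels share one N. *)
Lemma Lkernel_sum n N x y : (0 < n)%N -> (2 * n < N)%N ->
  Lkernel Omega m a w n x y = \sum_(0 <= k < N) a (k%:R / n%:R) * P k x y.
Proof.
move=> n0 nN; apply: cvg_lim => //; apply: cvg_near_cst.
exists N => // M /= NM; rewrite (big_cat_nat _ (n := N))//=.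
rewrite [X in _ + X]big_nat [X in _ + X]big1 ?addr0//.
move=> k /andP[Nk _]; rewrite (cutoff_ge2 a_cutoff) ?mul0r//.
rewrite ler_pdivlMr ?ltr0n// -natrM ler_nat.
exact: leq_trans (ltnW nN) Nk.
Qed.

Lemma Fkernel_sum j N x y : (2 ^ j < N)%N -> Omega x -> Omega y ->
  Fkernel Omega m a w j x y = \sum_(0 <= k < N) c j k * P k x y.
Proof.
move=> jN Ox Oy; case: j jN => [|i] jN /=.
  rewrite big_ltn; last exact: leq_trans jN.
  rewrite Pkernel0// eqxx mul1r big_nat big1 ?addr0// => k /andP[k0 _].
  by rewrite gtn_eqF// mul0r.
by apply: Lkernel_sum; [rewrite expn_gt0|rewrite -expnS].
Qed.

Definition level_part j N y := \sum_(0 <= k < N) c j k * v k y.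

(** Coefficients vanish above 2^j, so the degree bound does not depend on N. *)
Lemma level_Pi j N (g : nat -> T -> R) : (forall k, Pi Omega k (g k)) ->
  Pi Omega (2 ^ j) (fun y => \sum_(0 <= k < N) c j k * g k y).
Proof.
move=> Pg; apply: Pi_sum => k _.
have [kj|jk] := leqP k (2 ^ j); first exact: PiZ (Pi_leq kj (Pg k)).
by apply: eq_Pi (Pi_cst _ _ 0) => x _; rewrite (level_coef_eq0 a_cutoff) ?mul0r.
Qed.

Lemma inner_Fkernel j N z : (2 ^ j < N)%N -> Omega z ->
  << f, Fkernel Omega m a w j ^~ z >> = level_part j N z.
Proof.
move=> jN Oz.
have -> : << f, Fkernel Omega m a w j ^~ z >> =
    << f, (fun y => \sum_(0 <= k < N) c j k * P k z y) >>.
  apply: eq_inner => // y Oy; rewrite (Fkernel_sum jN)//.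
  by apply: eq_bigr => k _; rewrite P_sym.
rewrite inner_sumr// => [|k _]; last exact/square_integrableZ/sqP.
apply: eq_bigr => k _; rewrite innerZr//; last exact: sqP.
by rewrite (inner_Pkernel Omega_compact d_metric w_doubling).
Qed.

Lemma inner_psi j N z : (2 ^ j < N)%N -> Xi j z ->
  << f, psi j z >> = Num.sqrt (lambda j z) * level_part j N z.
Proof.
move=> jN Xz; have Oz := Xi_Omega Xz.
rewrite -(inner_Fkernel jN)// -innerZr//.
apply: (sqPi (n := 2 ^ j)); apply: eq_Pi (level_Pi j N (fun k => (PV k Oz).1)).
by move=> x Ox; rewrite (Fkernel_sum jN)//; apply: eq_bigr => k _; rewrite P_sym.
Qed.

(* The sums over Xi j are only rewritten termwise, so their junk value for an
   infinite support is harmless. *)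
Lemma frame_level j N x : (2 ^ j < N)%N -> Omega x ->
  \sum_(z \in Xi j) << f, psi j z >> * psi j z x =
  \sum_(0 <= k < N) c j k ^+ 2 * v k x.
Proof.
move=> jN Ox.
(* The kernel F_j(x, .) for fixed x, as a polynomial in the node variable. *)
pose F y := \sum_(0 <= k < N) c j k * P k x y.
have PF : Pi Omega (2 ^ j) F by exact: (level_Pi j N (fun k => (PV k Ox).1)).
have -> : \sum_(z \in Xi j) << f, psi j z >> * psi j z x =
    \sum_(z \in Xi j) lambda j z * (level_part j N z * F z).
  apply: eq_fsbigr => z /set_mem Xz; have Oz := Xi_Omega Xz.
  rewrite (inner_psi jN)// /frame (Fkernel_sum jN)// mulrACA -expr2 sqr_sqrtr//.
  exact/ltW/lambda_gt0.
rewrite -lambda_cubature; last first.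
  by rewrite expnS mul2n -addnn; exact: PiM (level_Pi j N vPi) PF.
(* The integral is an inner product. P_l(x, .) reproduces v_k if l = k and is orthogonal to it
   otherwise, so only diagonal terms survive. *)
rewrite -/(inner Omega m w (level_part j N) F) inner_suml//; first last.
- exact: sqPi PF.
- by move=> k _; exact: square_integrableZ.
rewrite big_nat [RHS]big_nat; apply: eq_bigr => k /andP[_ kN].
rewrite innerZl//; last exact: sqPi PF.
rewrite inner_sumr// => [|l _]; last exact/square_integrableZ/sqP.
rewrite (bigD1_seq k) ?mem_index_iota ?iota_uniq//=.
rewrite big1 => [|l lk]; rewrite innerZr
    ?(inner_Vcomponent_Pkernel Omega_compact d_metric w_doubling w_unit)//;
  try exact: sqP.
  by rewrite eqxx mul1r addr0 expr2 mulrA.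
by rewrite eq_sym (negbTE lk) mul0r mulr0.
Qed.

Lemma inner_vv k l : << v k, v l >> = (k == l)%:R * << v k, v k >>.
Proof.
have [->|/eqP kl] := eqVneq k l; first by rewrite mul1r.
rewrite mul0r; apply: Vspace_orthogonal kl _ _;
  exact: (Vcomponent_Vspace Omega_compact d_metric w_doubling).
Qed.

Lemma inner_fv k : << f, v k >> = << v k, v k >>.
Proof. exact: (inner_Vcomponent Omega_compact d_metric w_doubling). Qed.

Lemma inner_v_sum k N (b : nat -> R) : (k < N)%N ->
  << v k, (fun x => \sum_(0 <= l < N) b l * v l x) >> = b k * << v k, v k >>.
Proof.
move=> kN; rewrite inner_sumr// => [|l _]; last exact: square_integrableZ.
rewrite (bigD1_seq k) ?mem_index_iota ?iota_uniq//= innerZr//.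
rewrite big1 ?addr0// => l lk; rewrite innerZr// inner_vv.
by rewrite eq_sym (negbTE lk) mul0r mulr0.
Qed.

Lemma inner_sum_v N (b b' : nat -> R) :
  << (fun x => \sum_(0 <= l < N) b l * v l x),
     (fun x => \sum_(0 <= l < N) b' l * v l x) >> =
  \sum_(0 <= l < N) b l * b' l * << v l, v l >>.
Proof.
have ssum (e : nat -> R) : sqint (fun x => \sum_(0 <= l < N) e l * v l x).
  by apply: square_integrable_sum => // l _; exact: square_integrableZ.
rewrite inner_suml// => [|l _]; last exact: square_integrableZ.
rewrite big_nat [RHS]big_nat; apply: eq_bigr => k /andP[_ kN].
by rewrite innerZl// inner_v_sum// mulrA.
Qed.

(** As in [frame_level], with a second copy of [level_part] in place of the kernel. *)
Lemma frame_energy j N : (2 ^ j < N)%N ->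
  \sum_(z \in Xi j) `|<< f, psi j z >>| ^+ 2 =
  \sum_(0 <= k < N) c j k ^+ 2 * << v k, v k >>.
Proof.
move=> jN.
have -> : \sum_(z \in Xi j) `|<< f, psi j z >>| ^+ 2 =
    \sum_(z \in Xi j) lambda j z * (level_part j N z * level_part j N z).
  apply: eq_fsbigr => z /set_mem Xz.
  rewrite (inner_psi jN)// real_normK ?num_real// exprMn sqr_sqrtr ?expr2//.
  exact/ltW/lambda_gt0.
rewrite -lambda_cubature; last first.
  by rewrite expnS mul2n -addnn; exact: PiM (level_Pi j N vPi) (level_Pi j N vPi).
rewrite -/(inner Omega m w (level_part j N) (level_part j N)) inner_sum_v.
by apply: eq_bigr => k _; rewrite -expr2.
Qed.

End Frame.

(** * Convergence of energies and partial sums *)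

Section Convergence.
Context {R : realType} {dim : nat}.
Local Notation T := (euclid R dim).
Variables (Omega : set T) (m : {measure set T -> \bar R}) (d : T -> T -> R).
Variable w : T -> R.
Hypothesis Omega_compact : compact (Omega : set 'rV[R]_dim).
Hypothesis d_metric : metric_on Omega d.
Hypothesis w_doubling : doubling_weight Omega m d w.
Hypothesis w_unit : wmeas m w Omega = 1.
Variable a : R -> R.
Hypothesis a_cutoff : cutoff_b a.
Hypothesis a_square : forall t, 1 / 2 <= t <= 1 -> a t ^+ 2 + a (2 * t) ^+ 2 = 1.
Variable f : T -> R.
Hypothesis f_sqint : square_integrable Omega m w f.

Local Notation sqint := (square_integrable Omega m w).
Local Notation "<< f , g >>" := (inner Omega m w f g).
Local Notation v := (fun k => Vcomponent Omega m w k f).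
Local Notation q k := << v k, v k >>.

Let w_weight : weight Omega m w. Proof. by case: w_doubling. Qed.
Let Omega_measurable : measurable Omega.
Proof. exact: compact_euclid_measurable. Qed.
Let sqPi n g : Pi Omega n g -> sqint g.
Proof. exact: Pi_square_integrable. Qed.
Let sqv k : sqint (v k).
Proof. apply: sqPi; exact: (Vcomponent_Pi Omega_compact d_metric w_doubling). Qed.
Hint Resolve w_weight Omega_measurable sqv : core.

Lemma sum_v_sqint N (b : nat -> R) : sqint (fun x => \sum_(0 <= k < N) b k * v k x).
Proof. by apply: square_integrable_sum => // k _; exact: square_integrableZ. Qed.

Lemma inner_f_sum_v N (b : nat -> R) :
  << f, (fun x => \sum_(0 <= k < N) b k * v k x) >> = \sum_(0 <= k < N) b k * q k.
Proof.
rewrite inner_sumr// => [|k _]; last exact: square_integrableZ.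
apply: eq_bigr => k _; rewrite innerZr//.
by rewrite (inner_fv Omega_compact d_metric w_doubling w_unit).
Qed.

(** Since <f, v_k> = <v_k, v_k>, cross terms and squares combine termwise. *)
Lemma sqdist_sum_v N (b : nat -> R) :
  << (fun x => f x - \sum_(0 <= k < N) b k * v k x),
     (fun x => f x - \sum_(0 <= k < N) b k * v k x) >> =
  << f, f >> - \sum_(0 <= k < N) (2 * b k - b k ^+ 2) * q k.
Proof.
rewrite (inner_sqB Omega_measurable w_weight f_sqint (sum_v_sqint N b)).
rewrite inner_f_sum_v (inner_sum_v Omega_compact d_metric w_doubling w_unit)//.
rewrite mulr_sumr [in RHS](eq_bigr (fun k => 2 * (b k * q k) - b k * b k * q k)).
  by rewrite sumrB; ring.
by move=> k _; ring.
Qed.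

(** Let g be the projection of f to Pi_n. As <f, p> = <g, p>, the left side is |g|^2 - |g - p|^2,
    and |g|^2 is the sum on the right. *)
Lemma polynomial_energy n p : Pi Omega n p ->
  << f, f >> - << (fun x => f x - p x), (fun x => f x - p x) >> <=
  \sum_(0 <= k < n.+1) q k.
Proof.
move=> Pp; have sp := sqPi Pp.
pose g := Pi_proj Omega m w n f.
have sg : sqint g.
  by apply: sqPi; exact: (Pi_proj_Pi Omega_compact d_metric w_doubling w_unit n f).
have gE x : g x = \sum_(0 <= k < n.+1) 1 * v k x.
  by rewrite /g -sum_Vcomponent; apply: eq_bigr => k _; rewrite mul1r.
have -> : \sum_(0 <= k < n.+1) q k = << g, g >>.
  have -> : << g, g >> = << (fun x => \sum_(0 <= k < n.+1) 1 * v k x),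
      (fun x => \sum_(0 <= k < n.+1) 1 * v k x) >> by exact: eq_inner.
  rewrite (inner_sum_v Omega_compact d_metric w_doubling w_unit)//.
  by apply: eq_bigr => k _; rewrite !mul1r.
rewrite (inner_sqB Omega_measurable w_weight f_sqint sp).
rewrite -(Pi_proj_inner Omega_compact d_metric w_doubling w_unit f_sqint Pp) -/g.
have := inner_ge0 w_weight (fun x => g x - p x).
rewrite (inner_sqB Omega_measurable w_weight sg sp); lra.
Qed.

Definition level_energy n := \sum_(0 <= k < (2 ^ n.+1).+1) level_weight a n k * q k.

(** Weights in [0, 1] satisfy b <= 2b - b^2. This compares the energy with the sum that
    [sqdist_sum_v] subtracts from |f|^2. *)
Lemma level_energy_le n : level_energy n <=
  \sum_(0 <= k < (2 ^ n.+1).+1)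
    (2 * level_weight a n k - level_weight a n k ^+ 2) * q k.
Proof.
apply: ler_sum => k _; rewrite ler_wpM2r ?inner_ge0//.
have := level_weight_ge0 a n k; have := level_weight_le1 a_cutoff a_square n k; nra.
Qed.

(** The upper bound is the nonnegativity of the squared distance. For the lower bound, take a
    polynomial of degree at most N at squared distance at most e: once N < 2^n, all weights up to N
    are 1, so the energy is at least |f|^2 - e by [polynomial_energy]. *)
Lemma level_energy_cvg : level_energy n @[n --> \oo] --> << f, f >>.
Proof.
apply/cvgrPdist_le => e e0.
have [N [p Pp pe]] := polynomials_dense Omega_compact w_weight f_sqint e0.
exists N => // n /= Nn.
have up : level_energy n <= << f, f >>.
  apply: le_trans (level_energy_le n) _; rewrite -subr_ge0 -sqdist_sum_v.
  exact: inner_ge0.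
have lo : << f, f >> - e <= level_energy n.
  apply: le_trans (lerB (lexx _) pe) _; apply: le_trans (polynomial_energy Pp) _.
  have N2 : (N < 2 ^ n)%N by apply: leq_ltn_trans Nn _; rewrite ltn_expl.
  have NN : (N.+1 <= (2 ^ n.+1).+1)%N by rewrite ltnS ltnW// (ltn_trans N2)// ltn_exp2l.
  rewrite /level_energy [leRHS](big_cat_nat _ (n := N.+1))//= -[leLHS]addr0 lerD//.
    rewrite big_nat [leRHS]big_nat; apply: ler_sum => k /andP[_ kN].
    by rewrite (level_weight_eq1 a_cutoff a_square) ?mul1r// (leq_ltn_trans _ N2).
  apply: sumr_ge0 => k _; rewrite mulr_ge0 ?inner_ge0//; exact: level_weight_ge0.
by rewrite ler_norml; apply/andP; split; lra.
Qed.

Lemma sqdist_level_cvg :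
  << (fun x => f x - \sum_(0 <= k < (2 ^ n.+1).+1) level_weight a n k * v k x),
     (fun x => f x - \sum_(0 <= k < (2 ^ n.+1).+1) level_weight a n k * v k x) >>
  @[n --> \oo] --> 0.
Proof.
apply: (squeeze_cvgr (f := fun=> 0) (h := fun n => << f, f >> - level_energy n)).
- apply: nearW => n; rewrite inner_ge0//= sqdist_sum_v lerB//.
  exact: level_energy_le.
- exact: cvg_cst.
- rewrite -[X in _ --> X](subrr << f, f >>).
  by apply: cvgB; [exact: cvg_cst|exact: level_energy_cvg].
Qed.

End Convergence.

Lemma eq_norm2 (R : realType) (dim : nat) (Omega : set (euclid R dim))
  (m : {measure set (euclid R dim) -> \bar R}) w f g :
  (forall x, Omega x -> f x = g x) -> norm2 Omega m w f = norm2 Omega m w g.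
Proof.
by move=> fg; congr sqrte; apply: eq_integral => x /set_mem Ox; rewrite fg.
Qed.

(* F_j(x, .) has degree < 2^j, so the cubature has to be exact on products of
   two such kernels, that is on Pi_{2^(j+1)}. The normalization w_unit makes
   F_0 = 1 the reproducing kernel of the constants. *)
Theorem theorem2p21 (R : realType) (dim : nat)
  (Omega : set (euclid R dim)) (m : {measure set (euclid R dim) -> \bar R})
  (d : euclid R dim -> euclid R dim -> R)
  (d_metric : metric_on Omega d)
  (m_lebesgue : lebesgue_on Omega m)
  (m_doubling : doubling_measure Omega d m)
  (m_below : balls_bounded_below Omega d m)
  (varpi : euclid R dim -> R) (varpi_localizable : localizable Omega m d varpi)
  (w : euclid R dim -> R) (w_doubling : doubling_weight Omega m d w)
  (w_unit : wmeas m w Omega = 1)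
  (h4 : assertion4 Omega d)
  (a : R -> R) (a_cutoff : cutoff_b a)
  (a_lower : exists2 rho : R, 0 < rho &
     forall t, 3 / 5 <= t <= 5 / 3 -> rho <= a t)
  (a_square : forall t, 1 / 2 <= t <= 1 -> a t ^+ 2 + a (2 * t) ^+ 2 = 1)
  (delta cd : R) (delta_gt0 : 0 < delta) (cd_gt1 : 1 < cd)
  (Xi : nat -> set (euclid R dim))
  (Xi_maximal : forall j, maximal_separated Omega d cd (delta / 2 ^+ j) (Xi j))
  (lambda : nat -> euclid R dim -> R)
  (lambda_gt0 : forall j z, Xi j z -> 0 < lambda j z)
  (lambda_cubature : forall j f, Pi Omega (2 ^ j.+1) f ->
     \int[m]_(x in Omega) (f x * w x) = \sum_(z \in Xi j) lambda j z * f z)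
  (lambda_bounds : exists b1 b2 : R, [/\ 0 < b1, 0 < b2 &
     forall j z, Xi j z ->
       b1 * wmeas m w (dball Omega d z (2 ^- j)) <= lambda j z
         <= b2 * wmeas m w (dball Omega d z (2 ^- j))])
  (f : euclid R dim -> R) (f_L2 : L2 Omega m w f) :
  let psi := frame Omega m a w lambda in
  (norm2 Omega m w (fun x => f x -
      \sum_(0 <= j < J) \sum_(z \in Xi j)
         inner Omega m w f (psi j z) * psi j z x)
    @[J --> \oo] --> 0%E) /\
  norm2 Omega m w f =
    sqrte (\sum_(0 <= j <oo)
             (\sum_(z \in Xi j) `|inner Omega m w f (psi j z)| ^+ 2)%:E)%E.
Proof.
have Omega_compact : compact (Omega : set 'rV[R]_dim) by case: h4.
have Omega_measurable := compact_euclid_measurable Omega_compact.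
have w_weight : weight Omega m w by case: w_doubling.
have f_sqint := L2_square_integrable w_weight f_L2.
have Xi_Omega j : Xi j `<=` Omega by case: (Xi_maximal j) => -[].
move=> psi; pose v k := Vcomponent Omega m w k f.
(* The single cut 2^(n+1) + 1 serves all levels j <= n + 1. *)
have level_le j n : (j < n.+2)%N -> (2 ^ j < (2 ^ n.+1).+1)%N.
  by move=> jn; rewrite ltnS leq_exp2l.
have sumE n x : Omega x ->
    \sum_(0 <= j < n + 2) \sum_(z \in Xi j) inner Omega m w f (psi j z) * psi j z x =
    \sum_(0 <= k < (2 ^ n.+1).+1) level_weight a n k * v k x.
  move=> Ox; rewrite addn2 big_nat.
  under eq_bigr => j /andP[_ jn] do
    rewrite (frame_level Omega_compact d_metric w_doubling w_unit a_cutoff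
      Xi_Omega lambda_gt0 lambda_cubature f_sqint (level_le j n jn) Ox).
  rewrite -big_nat exchange_big/=; apply: eq_bigr => k _.
  by rewrite /level_weight mulr_suml.
have energyE n :
    \sum_(0 <= j < n + 2) \sum_(z \in Xi j) `|inner Omega m w f (psi j z)| ^+ 2 =
    level_energy Omega m w a f n.
  rewrite addn2 big_nat.
  under eq_bigr => j /andP[_ jn] do
    rewrite (frame_energy Omega_compact d_metric w_doubling w_unit a_cutoff
      Xi_Omega lambda_gt0 lambda_cubature f_sqint (level_le j n jn)).
  rewrite -big_nat exchange_big/=; apply: eq_bigr => k _.
  by rewrite /level_weight mulr_suml.
have fv_sqint n : square_integrable Omega m w (fun x => f x -
    \sum_(0 <= k < (2 ^ n.+1).+1) level_weight a n k * v k x).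
  apply: square_integrableB => //.
  exact: (sum_v_sqint Omega_compact d_metric w_doubling w_unit f_sqint).
split.
(* Dropping two partial sums keeps the limit and matches J = n + 2 with [level_weight a n]. *)
- rewrite -(cvg_shiftn 2)/=.
  under eq_cvg => n.
    rewrite (eq_norm2 m w (g := fun x => f x -
      \sum_(0 <= k < (2 ^ n.+1).+1) level_weight a n k * v k x)); last first.
      by move=> x Ox; rewrite sumE.
    rewrite (norm2_inner Omega_measurable w_weight (fv_sqint n)).
    over.
  apply: cvg_EFin; first exact: nearW.
  rewrite -[X in _ --> X]sqrtr0; apply: (cvg_comp _ _ (sqdist_level_cvg
    Omega_compact d_metric w_doubling w_unit a_cutoff a_square f_sqint)).
  exact: sqrt_continuous.
- rewrite norm2_inner//; have -> : (\sum_(0 <= j <oo)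
      (\sum_(z \in Xi j) `|inner Omega m w f (psi j z)| ^+ 2)%:E)%E =
      (inner Omega m w f f)%:E; last by [].
  apply: cvg_lim => //; rewrite -(cvg_shiftn 2)/=.
  under eq_cvg => n do rewrite sumEFin energyE.
  apply: cvg_EFin; first exact: nearW.
  exact: (level_energy_cvg Omega_compact d_metric w_doubling w_unit a_cutoff
    a_square f_sqint).
Qed.
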